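(* Let $M$ be a compact, orientable, $n$-dimensional smooth manifold equipped with a smooth Riemannian metric $g_0$ of total volume $1$. Then the metric space $(\bar{\mathcal{E}}_{L^2}, d_{L^2})$ of (classes of) square integrable measurable sections of the fiberwise completed bundle $\bar{E}\to M$ of positive-definite symmetric $(0,2)$-tensors is isometric to $L^2(M,\bar{P}(n))$.
   Context: Manifolds are nonempty and $n\ge 1$. Let $\mu_{g_0}$ be the volume measure of $g_0$. The bundle $E$: for $p\in M$ let $S^2T_p^*M$ be the vector space of symmetric $(0,2)$-tensors at $p$ and $E_p=S^2_+T_p^*M$ the open subset of positive-definite ones; $E=\bigsqcup_p E_p$ is a fiber bundle over $M$ with fiber $P(n)$, the space of $n\times n$ real positive-definite symmetric matrices. On $E_p$ consider the Riemannian metric which, for $h\in E_p$ and $a,b\in T_hE_p\cong S^2T_p^*M$, is $$\langle a,b\rangle_{h,p}=\mathrm{tr}(h^{-1}ah^{-1}b)\cdot\sqrt{\det(g_0(p)^{-1}h)},$$ where $h^{-1}a$ (etc.) denotes the endomorphism of $T_pM$ obtained by raising an index. Let $d_p$ be the induced Riemannian distance on $E_p$. The model fiber: on $P(n)$ consider the Riemannian metric $\langle A,B\rangle_H=\mathrm{tr}(H^{-1}AH^{-1}B)\cdot\sqrt{\det H}$ for $H\in P(n)$ and $A,B\in T_HP(n)$ (symmetric matrices), let $d_{P(n)}$ be the induced distance and $(\bar{P}(n),d_{P(n)})$ the metric completion of $(P(n),d_{P(n)})$. The bundle $\bar{E}$: cover $M$ by charts sending $\mu_{g_0}$ to the Euclidean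 volume. In such a chart, writing tensors as matrices in the coordinate frame identifies each $(E_p,d_p)$ isometrically with $(P(n),d_{P(n)})$. The changes of coordinates act on $(P(n),d_{P(n)})$ by isometries, which extend to isometries of $\bar{P}(n)$ and define a fiber bundle $\bar{E}\to M$ with fiber $\bar{P}(n)$. Its fiber $(\bar{E}_p,d_p)$ is the metric completion of $(E_p,d_p)$, with $d_p$ also denoting the extended distance. Sections: $\bar{\mathcal{E}}_{L^2}$ is the set of Borel measurable global sections $\sigma:M\to\bar{E}$ with $\int_M d_p^2(\sigma(p),g_0(p))\,d\mu_{g_0}(p)<\infty$, modulo equality $\mu_{g_0}$-almost everywhere, with distance $$d_{L^2}(\sigma,\sigma')=\left(\int_M d_p^2(\sigma(p),\sigma'(p))\,d\mu_{g_0}(p)\right)^{1/2}.$$ The space $L^2(M,\bar{P}(n))$: the set of Borel measurable maps $f:M\to\bar{P}(n)$ with $\int_M d_{P(n)}^2(f(p),A)\,d\mu_{g_0}(p)<\infty$ for some (hence any) $A\in\bar{P}(n)$, modulo equality $\mu_{g_0}$-almost everywhere, with distance $$d_{L^2}(f,g)=\left(\int_M d_{P(n)}^2(f(p),g(p))\,d\mu_{g_0}(p)\right)^{1/2}.$$ ''Isometric'' means that there is a bijective distance-preserving map. *)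

(* Defs.v *)
From HB Require Import structures.
From mathcomp Require Import all_boot all_order all_algebra.
From mathcomp Require Import all_classical all_reals all_analysis.

Set Implicit Arguments.
Unset Strict Implicit.
Unset Printing Implicit Defensive.

Import Order.TTheory GRing.Theory Num.Theory.
Import numFieldNormedType.Exports.

Local Open Scope classical_set_scope.
Local Open Scope ring_scope.

Section Quotient.
Variables (T : Type) (E : T -> T -> Prop).

Definition quotient := {S : set T | exists x, S = E x}.

Definition cls (x : T) : quotient := exist _ (E x) (ex_intro _ x erefl).

Definition rep (S : quotient) : T := projT1 (cid (proj2_sig S)).

End Quotient.

Section Metric.
Variables (R : realType) (X : Type) (d : X -> X -> R).

Definition metric_open : set (set X) :=
  [set W | forall x, W x -> exists2 e, 0 < e & forall y, d x y < e -> W y].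

Definition cauchy_seq (u : nat -> X) : Prop :=
  forall e, 0 < e ->
    exists N, forall i j, (N <= i)%N -> (N <= j)%N -> d (u i) (u j) < e.

Definition asymptotic (u v : {u : nat -> X | cauchy_seq u}) : Prop :=
  d (sval u i) (sval v i) @[i --> \oo] --> (0 : R).

Definition completion := quotient asymptotic.

Definition completion_dist (x y : completion) : R :=
  limn (fun i => d (sval (rep x) i) (sval (rep y) i)).

Lemma cauchy_cst (dxx : forall x, d x x = 0) (x : X) :
  cauchy_seq (fun=> x).
Proof. by move=> e e0; exists 0%N => i j _ _; rewrite dxx. Qed.

Definition completion_in (dxx : forall x, d x x = 0) (x : X) : completion :=
  cls asymptotic (exist _ (fun=> x) (cauchy_cst dxx x)).

End Metric.

Section CompletionTopology.
Variables (R : realType) (X : Type) (d : X -> X -> R).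

HB.instance Definition _ := gen_eqMixin (completion d).
HB.instance Definition _ := gen_choiceMixin (completion d).

Let op := metric_open (@completion_dist R X d).

Let opT : op setT.
Proof. by move=> x _; exists 1. Qed.

Let opI : setI_closed op.
Proof.
move=> A B oA oB x [/oA[e e0 eA] /oB[f f0 fB]].
exists (Num.min e f); first by rewrite lt_min e0 f0.
by move=> y; rewrite lt_min => /andP[ye yf]; split; [exact: eA|exact: fB].
Qed.

Let op_bigU (I : Type) (f : I -> set (completion d)) :
  (forall i, op (f i)) -> op (\bigcup_i f i).
Proof.
move=> of_ x [i _ /of_[e e0 ef]]; exists e => // y xy.
by exists i => //; exact: ef.
Qed.

HB.instance Definition _ :=
  isOpenTopological.Build (completion d) opT opI op_bigU.

End CompletionTopology.

(* The graph of the continuous extension to the completions of an isometry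
   f : X -> Y: the class of a Cauchy sequence u is sent to that of f \o u. *)
Definition completion_map_graph (R : realType) (X Y : Type)
    (dX : X -> X -> R) (dY : Y -> Y -> R) (f : X -> Y)
    (x : completion dX) (y : completion dY) : Prop :=
  exists u v, [/\ sval x u, sval y v & forall i, sval v i = f (sval u i)].

Definition isometric (R : realType) (X Y : Type)
    (dX : X -> X -> R) (dY : Y -> Y -> R) : Prop :=
  exists2 F : X -> Y, bijective F & forall x x', dY (F x) (F x') = dX x x'.

Definition borel (M : ptopologicalType) := g_sigma_algebraType (@open M).

Definition borel_map (M : ptopologicalType) (Y : Type) (opY : set (set Y))
    (f : M -> Y) : Prop :=
  forall B, <<s opY>> B -> measurable (f @^-1` B : set (borel M)).

Section ProductPower.
Context d (T : measurableType d) (R : realType).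
Variable l : {sigma_finite_measure set T -> \bar R}.

Definition tcons n (z : T * n.-tuple T) : n.+1.-tuple T :=
  [tuple of z.1 :: z.2].

Lemma measurable_tcons n : measurable_fun [set: T * n.-tuple T] (@tcons n).
Proof.
by apply: (@measurable_cons _ _ _ T fst n snd);
  [exact: measurable_fst|exact: measurable_snd].
Qed.

Definition measure_cons n
    (m : {sigma_finite_measure set (n.-tuple T) -> \bar R}) :
    set (n.+1.-tuple T) -> \bar R :=
  pushforward (l \x m)%E (@tcons n).

Section Instances.
Variables (n : nat) (m : {sigma_finite_measure set (n.-tuple T) -> \bar R}).

Let measure_cons0 : measure_cons m set0 = 0%E.
Proof. by rewrite /measure_cons /pushforward preimage_set0 measure0. Qed.

Let measure_cons_ge0 A : (0 <= measure_cons m A)%E.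
Proof. by rewrite /measure_cons /pushforward measure_ge0. Qed.

Let measure_cons_sigma_additive : semi_sigma_additive (measure_cons m).
Proof.
move=> F mF tF mUF; rewrite /measure_cons /pushforward preimage_bigcup.
have mt := @measurable_tcons n.
apply: measure_semi_sigma_additive.
- by move=> k; rewrite -[X in measurable X]setTI; exact: mt.
- apply/trivIsetP => /= i j _ _ ij; rewrite -preimage_setI.
  by move/trivIsetP : tF => /(_ _ _ _ _ ij) ->//; rewrite preimage_set0.
- by rewrite -preimage_bigcup -[X in measurable X]setTI; exact: mt.
Qed.

HB.instance Definition _ := isMeasure.Build _ _ _ (measure_cons m)
  measure_cons0 measure_cons_ge0 measure_cons_sigma_additive.

Let measure_cons_sigma_finite : sigma_finite setT (measure_cons m).
Proof.
have /sigma_finiteP[F [UF ndF Foo]] := sigma_finiteT l.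
have /sigma_finiteP[G [UG ndG Goo]] := sigma_finiteT m.
pose uncons (t : n.+1.-tuple T) : T * n.-tuple T :=
  (thead t, [tuple of behead t]).
have mu : measurable_fun setT uncons.
  apply/measurable_fun_pairP; split; first exact: measurable_tnth.
  exact: measurable_behead.
have uK z : uncons (tcons z) = z.
  by case: z => x t; rewrite /uncons /tcons /=; congr pair; apply/val_inj.
exists (fun k => uncons @^-1` (F k `*` G k)).
  rewrite -preimage_bigcup (_ : \bigcup_i _ = setT) ?preimage_setT//.
  apply/seteqP; split=> // -[x y] _.
  have [i _ Fx] : (\bigcup_i F i) x by rewrite -UF.
  have [j _ Gy] : (\bigcup_i G i) y by rewrite -UG.
  exists (maxn i j) => //; split=> /=.
    by move: x Fx; exact/subsetPset/ndF/leq_maxl.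
  by move: y Gy; exact/subsetPset/ndG/leq_maxr.
move=> k; have [mF Fk] := Foo k; have [mG Gk] := Goo k.
have mFG : measurable (F k `*` G k) by exact: measurableX.
split; first by rewrite -[X in measurable X]setTI; exact: mu.
rewrite /measure_cons /pushforward.
have -> : @tcons n @^-1` (uncons @^-1` (F k `*` G k)) = F k `*` G k.
  by apply/funext => z; rewrite /preimage/mkset uK.
by rewrite product_measure1E// lte_mul_pinfty// ge0_fin_numE.
Qed.

HB.instance Definition _ :=
  Measure_isSigmaFinite.Build _ _ _ (measure_cons m)
    measure_cons_sigma_finite.

End Instances.

Fixpoint measure_power n : {sigma_finite_measure set (n.-tuple T) -> \bar R} :=
  match n with
  | 0 => \d_([tuple] : 0.-tuple T)
  | n'.+1 => measure_cons (measure_power n')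
  end.

End ProductPower.

Section Lebesgue.
Variable R : realType.
Local Notation mR := (measurableTypeR R).

Definition lebesgue_n n : {sigma_finite_measure set (n.-tuple mR) -> \bar R} :=
  measure_power (@lebesgue_measure R) n.

(* The identification of R^n as a measurable space with 'rV[R]_n. *)
Definition row_of_tuple n (t : n.-tuple mR) : 'rV[R]_n := \row_i tnth t i.

End Lebesgue.

Fixpoint diff_upto (R : realType) n (V : normedModType R) (k : nat)
    (U : set 'rV[R]_n) (f : 'rV[R]_n -> V) : Prop :=
  match k with
  | 0 => forall x, U x -> {for x, continuous f}
  | k'.+1 => (forall x, U x -> differentiable f x) /\
      forall i : 'I_n, diff_upto k' U (fun x => 'D_(delta_mx 0 i) f x)
  end.

(* Meant for an open U: being C^oo amounts to being differentiable together
   with all the iterated partial derivatives. *)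
Definition smooth_on (R : realType) n (V : normedModType R)
    (U : set 'rV[R]_n) (f : 'rV[R]_n -> V) : Prop :=
  forall k, diff_upto k U f.

(* cmap and cinv are only meaningful on cdom and on cmap @` cdom. *)
Record chart (R : realType) (n : nat) (M : topologicalType) := Chart {
  cdom : set M ;
  cmap : M -> 'rV[R]_n ;
  cinv : 'rV[R]_n -> M ;
  cdom_open : open cdom ;
  cimg_open : open (cmap @` cdom) ;
  cmapK : forall p, cdom p -> cinv (cmap p) = p ;
  cmap_continuous : forall p, cdom p -> {for p, continuous cmap} ;
  cinv_continuous : forall p, cdom p -> {for cmap p, continuous cinv}
}.

Section Manifold.
Variables (R : realType) (n : nat) (M : ptopologicalType).
Local Notation chart := (chart R n M).

Definition transition (c c' : chart) : 'rV[R]_n -> 'rV[R]_n :=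
  cmap c' \o cinv c.

Definition smooth_transition (c c' : chart) : Prop :=
  smooth_on (cmap c @` (cdom c `&` cdom c')) (transition c c').

Record smooth_atlas := SmoothAtlas {
  atlas : set chart ;
  atlas_cover : forall p, exists2 c, atlas c & cdom c p ;
  atlas_smooth : forall c c', atlas c -> atlas c' -> smooth_transition c c'
}.

Variable A : smooth_atlas.

(* The maximal atlas: all the charts of the smooth structure. *)
Definition smooth_chart : set chart :=
  [set c | forall c', atlas A c' ->
    smooth_transition c c' /\ smooth_transition c' c].

Definition charts_at (p : M) : set chart :=
  [set c | smooth_chart c /\ cdom c p].

Definition jac (c c' : chart) (p : M) : 'M[R]_n :=
  jacobian (transition c c') (cmap c p).

Definition orientable : Prop :=
  exists O : set chart,
    [/\ O `<=` smooth_chart,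
        forall p, exists2 c, O c & cdom c p &
        forall c c' p, O c -> O c' -> cdom c p -> cdom c' p ->
          0 < \det (jac c c' p)].

Lemma charts_at_ex (p : M) : exists c, charts_at p c.
Proof.
have [c Ac cp] := atlas_cover A p; exists c; split=> // c' Ac'.
by split; [exact: atlas_smooth Ac Ac'|exact: atlas_smooth Ac' Ac].
Qed.

Definition chart_at (p : M) : chart := projT1 (cid (charts_at_ex p)).

Lemma chart_atP (p : M) : charts_at p (chart_at p).
Proof. exact: projT2 (cid (charts_at_ex p)). Qed.

Definition posdef (H : 'M[R]_n) : Prop :=
  H^T = H /\ forall v : 'rV[R]_n, v != 0 -> 0 < (v *m H *m v^T) 0 0.

Definition spd := {H : 'M[R]_n | posdef H}.

(* S^2 T_p^*M: a symmetric (0,2)-tensor h at p, given by its matrices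
   (h (d/dx^i, d/dx^j))_ij in all the coordinate frames at p, subject to the
   tensor transformation law.  The derivatives of a change of coordinates act
   on row vectors: jac c c' p i j = d y^j / d x^i.  The components are set to
   zero for the charts which are not charts at p. *)
Record sym_tensor (p : M) := SymTensor {
  tmat :> chart -> 'M[R]_n ;
  tmat_out : forall c, ~ charts_at p c -> tmat c = 0 ;
  tmat_sym : forall c, charts_at p c -> (tmat c)^T = tmat c ;
  tmat_change : forall c c', charts_at p c -> charts_at p c' ->
    tmat c = jac c c' p *m tmat c' *m (jac c c' p)^T
}.

Record pos_tensor (p : M) := PosTensor {
  ptensor :> sym_tensor p ;
  ptensor_pos : forall c, charts_at p c -> posdef (ptensor c)
}.

Definition coord_matrix (p : M) (c : chart) (cp : charts_at p c)
    (h : pos_tensor p) : spd :=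
  exist _ (h c) (ptensor_pos h cp).

Section RiemannianDistance.
(* A Riemannian manifold X with a global coordinate system crd with values in
   a space of matrices: metric x a b is the scalar product at x of the tangent
   vectors with coordinates a and b. *)
Variables (X : Type) (crd : X -> 'M[R]_n).
Variable metric : X -> 'M[R]_n -> 'M[R]_n -> R.

Definition C1 (f : R -> 'M[R]_n) : Prop :=
  (forall t, derivable f t 1) /\ continuous (derive1 f).

(* Only the restriction of a curve to [0, 1] matters.  The subdivision is
   0 :: rcons s 1, and on each closed piece the curve is C^1, i.e. it is the
   restriction of a C^1 function on the real line. *)
Definition piecewise_C1 (g : R -> X) : Prop :=
  exists2 s : seq R, path <%R 0 (rcons s 1) &
    forall i, (i <= size s)%N -> exists2 f, C1 f &
      forall t, (0 :: rcons s 1)`_i <= t <= (0 :: rcons s 1)`_i.+1 ->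
        crd (g t) = f t.

Definition curve_length (g : R -> X) : R :=
  let v := derive1 (crd \o g) in
  \int[lebesgue_measure]_(t in `[0, 1]%classic)
    Num.sqrt (metric (g t) (v t) (v t)).

Definition riemannian_dist (x y : X) : R :=
  inf [set curve_length g | g in
    [set g : R -> X | [/\ piecewise_C1 g, g 0 = x & g 1 = y]]].

Lemma riemannian_distxx (metric0 : forall x, metric x 0 0 = 0) (x : X) :
  riemannian_dist x x = 0.
Proof.
rewrite /riemannian_dist; set L := (X in inf X).
have lbL : lbound L 0.
  by move=> _ [g _ <-]; apply: Rintegral_ge0 => t _; exact: sqrtr_ge0.
have L0 : L 0.
  exists (fun=> x); last first.
    rewrite /curve_length/= (_ : (fun t => _) = cst 0).
      by rewrite /Rintegral integral0.
    apply/funext => t.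
    rewrite (_ : _ \o _ = cst (crd x)) // derive1E derive_cst.
    by rewrite metric0 sqrtr0.
  split=> //; exists [::]; first by rewrite /= ltr01.
  move=> i _; exists (cst (crd x)) => //; split=> [t|].
    exact: derivable_cst.
  rewrite (_ : derive1 _ = cst 0); first exact: cst_continuous.
  by apply/funext => t; rewrite derive1E derive_cst.
apply/eqP; rewrite eq_le; apply/andP; split.
  by apply: ge_inf => //; exists 0.
by apply: lb_le_inf => //; exists 0.
Qed.

End RiemannianDistance.

Definition ebin_metric (G H a b : 'M[R]_n) : R :=
  \tr (invmx H *m a *m invmx H *m b) * Num.sqrt (\det (invmx G *m H)).

Lemma ebin_metric0 G H : ebin_metric G H 0 0 = 0.
Proof. by rewrite /ebin_metric !mulmx0 mxtrace0 mul0r. Qed.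

Definition spd_metric (H : spd) (a b : 'M[R]_n) : R :=
  \tr (invmx (sval H) *m a *m invmx (sval H) *m b)
    * Num.sqrt (\det (sval H)).

Definition spd_dist : spd -> spd -> R :=
  riemannian_dist (fun H : spd => sval H) spd_metric.

Definition spd_bar := completion spd_dist.

Definition spd_bar_dist : spd_bar -> spd_bar -> R :=
  @completion_dist R spd spd_dist.

Record riemannian_metric := RiemannianMetric {
  rmetric :> forall p, pos_tensor p ;
  rmetric_smooth : forall c, smooth_chart c ->
    smooth_on (cmap c @` cdom c) (fun x => rmetric (cinv c x) c : 'M[R]_n)
}.

Variable g0 : riemannian_metric.

(* The metric of E_p in the coordinates of a chart at p; its value does not
   depend on the chart, by the transformation law of tensors. *)
Definition fiber_metric (p : M) (h : pos_tensor p) (a b : 'M[R]_n) : R :=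
  ebin_metric (g0 p (chart_at p)) (h (chart_at p)) a b.

Definition fiber_dist (p : M) : pos_tensor p -> pos_tensor p -> R :=
  riemannian_dist (fun h : pos_tensor p => h (chart_at p)) (@fiber_metric p).

Lemma fiber_distxx (p : M) (h : pos_tensor p) : fiber_dist h h = 0.
Proof. by apply: riemannian_distxx => x; exact: ebin_metric0. Qed.

Definition fiber_bar (p : M) := completion (@fiber_dist p).

Definition fiber_bar_dist (p : M) : fiber_bar p -> fiber_bar p -> R :=
  @completion_dist R (pos_tensor p) (@fiber_dist p).

Definition g0_section (p : M) : fiber_bar p :=
  completion_in (@fiber_distxx p) (g0 p).

Variable mu : {measure set (borel M) -> \bar R}.

Definition volume_measure : Prop :=
  forall c, smooth_chart c ->
  forall B : set (borel M), measurable B -> B `<=` cdom c ->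
    mu B = (\int[lebesgue_n R n]_(t in @row_of_tuple R n @^-1` (cmap c @` B))
      (Num.sqrt (\det (g0 (cinv c (row_of_tuple t)) c : 'M[R]_n)))%:E)%E.

Definition volume_preserving (c : chart) : Prop :=
  forall B : set (borel M), measurable B -> B `<=` cdom c ->
    mu B = lebesgue_n R n (@row_of_tuple R n @^-1` (cmap c @` B)).

(* The charts used below as local trivializations of the completed bundle:
   det g0 = 1 in such a chart, so that coord_matrix is an isometry. *)
Record volume_cover := VolumeCover {
  vcharts : set chart ;
  vcharts_smooth : vcharts `<=` smooth_chart ;
  vcharts_volume : forall c, vcharts c -> volume_preserving c ;
  vcharts_cover : forall p, exists2 c, vcharts c & cdom c p
}.

Variable V : volume_cover.

Definition bundle_bar := {p : M & fiber_bar p}.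

(* W is open iff its image is open in M * P(n)-bar under each local
   trivialization cdom c * P(n)-bar <-> bundle_bar over cdom c, which is on
   each fiber the extension of coord_matrix to the completions. *)
Definition bundle_open : set (set bundle_bar) :=
  [set W | forall c, vcharts V c ->
    open [set z : M * spd_bar | exists (cp : charts_at z.1 c)
      (y : fiber_bar z.1), W (existT _ z.1 y) /\
        completion_map_graph (coord_matrix cp) y z.2]].

Definition ae_classes (F : M -> Type) (Q : set (forall p, F p)) :=
  @quotient {s : forall p, F p | Q s}
    (fun s t => {ae mu, forall p, sval s p = sval t p}).

Definition L2_dist (F : M -> Type) (d : forall p, F p -> F p -> R)
    (Q : set (forall p, F p)) (s t : ae_classes Q) : R :=
  Num.sqrt (\int[mu]_p (d p (sval (rep s) p) (sval (rep t) p) ^+ 2)).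

Definition L2_section (s : forall p, fiber_bar p) : Prop :=
  borel_map bundle_open (fun p => existT fiber_bar p (s p)) /\
  (\int[mu]_p ((fiber_bar_dist (s p) (g0_section p)) ^+ 2)%:E < +oo)%E.

Definition L2_map (f : M -> spd_bar) : Prop :=
  borel_map (@open spd_bar) f /\
  exists a : spd_bar,
    (\int[mu]_p ((spd_bar_dist (f p) a) ^+ 2)%:E < +oo)%E.

Definition L2_sections := ae_classes L2_section.
Definition L2_sections_dist : L2_sections -> L2_sections -> R :=
  @L2_dist fiber_bar fiber_bar_dist L2_section.

Definition L2_maps := @ae_classes (fun=> spd_bar) L2_map.
Definition L2_maps_dist : L2_maps -> L2_maps -> R :=
  @L2_dist (fun=> spd_bar) (fun=> spd_bar_dist) L2_map.

End Manifold.

(* Main.v *)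
(**
In a chart that preserves volume, det g0 = 1, so writing tensors as matrices in
such a chart maps (E_p, d_p) isometrically onto (P(n), d_P(n)), and this extends
to the completions.  By compactness M is covered by finitely many open sets, each
inside a volume chart in which the matrix of g0 stays at bounded distance from
the identity; sending p to the first of them that contains p gives a finite Borel
partition of M.  Reading a section on each piece in the corresponding chart is a
fibrewise isometric bijection from sections to maps.  It preserves Borel
measurability because the changes of trivialization act jointly continuously on
M * P(n)-bar, and square integrability because g0 is read at bounded distance
from a constant map.
*)
Require Import Defs.
From mathcomp Require Import all_boot all_order all_algebra.
From mathcomp Require Import all_classical all_reals all_analysis.
From mathcomp Require Import measurable_realfun.

Set Implicit Arguments.
Unset Strict Implicit.
Unset Printing Implicit Defensive.

Import Order.TTheory GRing.Theory Num.Theory.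
Import numFieldNormedType.Exports.

Local Open Scope classical_set_scope.
Local Open Scope ring_scope.

(** * Integrals of functions that need not be measurable *)

(* The integral of a nonnegative function is a supremum over the simple functions
   below it, which is meaningful without measurability: the suffix _nm marks
   the lemmas that do not assume it. *)
Section LowerIntegral.
Local Open Scope ereal_scope.
Context d (T : measurableType d) (R : realType).
Import HBNNSimple.
Variable mu : {measure set T -> \bar R}.
Implicit Types (f g : T -> \bar R) (D : set T).

(** Two obstacles shape the proof. The first is measurability: neither the speed of a curve nor the
    fibrewise distance between two sections comes with a measurability proof. Integrals are
    therefore handled as suprema over measurable minorants. Monotonicity, subadditivity over
    measurable covers, affine substitution and invariance off null sets survive as inequalities, and
    these are enough for the triangle inequality of Riemannian distances and for the estimates in
    L2. The second is that a point of the completed fiber has no matrix, so a change of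
    trivialization has no formula on it. Such a point is replaced by a nearby positive-definite
    matrix, on which the change is congruence by a Jacobian; since each change is an isometry, the
    error of the replacement does not grow. The return from maps to sections also compares Borel
    maps with open sets of a product; a countable base of [M] cuts such an open set into countably
    many rectangles. *)

Lemma ge0_le_integral_nm D f g : (forall x, D x -> 0 <= f x) ->
  (forall x, D x -> f x <= g x) ->
  \int[mu]_(x in D) f x <= \int[mu]_(x in D) g x.
Proof.
move=> f0 fg; rewrite ge0_integralE// ge0_integralE; last first.
  by move=> x Dx; exact: le_trans (f0 x Dx) (fg x Dx).
apply: ereal_sup_le => /= _ [h hf <-]; exists h => // x.
apply: le_trans (hf x) _; rewrite /patch; case: ifPn => // /set_mem Dx.
exact: fg.
Qed.

(** The passage from measurable to arbitrary integrands: each bound below is proved for a measurable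
    minorant [h], where additivity and linearity are available, and then goes to the supremum. *)
Lemma ge0_integral_le_sup f K : (forall x, 0 <= f x) ->
  (forall h : T -> R, measurable_fun setT h -> (forall x, 0 <= h x)%R ->
    (forall x, (h x)%:E <= f x) -> \int[mu]_x (h x)%:E <= K) ->
  \int[mu]_x f x <= K.
Proof.
move=> f0 hK; rewrite ge0_integralTE//; apply: ge_ereal_sup => _ /= [h hf <-].
have := integral_nnsfun mu measurableT h; rewrite patch_setT => <-.
by apply: hK => // x; exact: fun_ge0.
Qed.

(** A measurable minorant of one function loses no mass when the null set is removed, and off that
    set it is a minorant of the other function. *)
Lemma ae_eq_integral_nm f g : (forall x, 0 <= f x) -> (forall x, 0 <= g x) ->
  {ae mu, forall x, f x = g x} -> \int[mu]_x f x = \int[mu]_x g x.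
Proof.
have le_ f' g' : (forall x, 0 <= f' x) -> (forall x, 0 <= g' x) ->
  {ae mu, forall x, f' x = g' x} -> \int[mu]_x f' x <= \int[mu]_x g' x.
  move=> f0 g0 [N [mN N0 fgN]]; apply: ge0_integral_le_sup => // h mh h0 hf.
  have -> : \int[mu]_x (h x)%:E = \int[mu]_(x in ~` N) (h x)%:E.
    rewrite -setTD (ge0_negligible_integral mN)//.
    - exact/measurable_EFinP.
    - by move=> x _; rewrite lee_fin.
  rewrite integral_mkcond; apply: ge0_le_integral_nm => x _.
    by rewrite /patch; case: ifP => // _; rewrite lee_fin.
  rewrite /patch; case: ifPn => // /set_mem Nx.
  by rewrite (le_trans (hf x))//; have /contrapT -> : ~ ~ f' x = g' x by move=> /fgN.
move=> f0 g0 fg; apply/eqP; rewrite eq_le !le_//.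
by case: fg => N [mN N0 fgN]; exists N; split=> // x /= gf; apply: fgN => /= /esym.
Qed.

(** A minorant of [f] restricted to [D] vanishes off [D], so its integral splits over the measurable
    cover once [D2] is made disjoint from [D1]. *)
Lemma integral_setU_le_nm D D1 D2 f : measurable D1 -> measurable D2 ->
  D `<=` D1 `|` D2 -> (forall x, 0 <= f x) ->
  \int[mu]_(x in D) f x <= \int[mu]_(x in D1) f x + \int[mu]_(x in D2) f x.
Proof.
move=> m1 m2 DD f0.
have r0 D' x : 0 <= (f \_ D') x by rewrite /patch; case: ifP.
rewrite integral_mkcond; apply: ge0_integral_le_sup => [//|h mh h0 hf].
have h0' x : 0 <= (h x)%:E by rewrite lee_fin.
have hD x : ~ D x -> h x = 0%R.
  move=> Dx; apply/eqP; rewrite eq_le h0 andbT -lee_fin.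
  by rewrite (le_trans (hf x))// /patch memNset.
have hDf D' x : D' x -> (h x)%:E <= f x.
  by move=> _; rewrite (le_trans (hf x))// /patch; case: ifP.
have -> : \int[mu]_x (h x)%:E = \int[mu]_(x in D1 `|` D2) (h x)%:E.
  rewrite [RHS]integral_mkcond; apply: eq_integral => x _.
  by rewrite /patch; case: ifPn => // /negP Dx; rewrite hD// => /DD/mem_set.
have -> : D1 `|` D2 = D1 `|` (D2 `\` D1) by rewrite setDE setUIr setUv setIT.
have mh' : measurable_fun setT (fun x => (h x)%:E) by exact/measurable_EFinP.
have mD2 : measurable (D2 `\` D1) by exact: measurableD.
rewrite ge0_integral_setU//; last 2 first.
- exact: measurable_funS mh'.
- by apply/disj_setPS => x [D1x [_]]; exact.
apply: leeD; first by apply: ge0_le_integral_nm => // x; exact: hDf.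
apply: le_trans (_ : \int[mu]_(x in D2) (h x)%:E <= _).
  by apply: ge0_subset_integral => //; exact: measurable_funS mh'.
by apply: ge0_le_integral_nm => // x; exact: hDf.
Qed.

(** With [u] and [v] possibly non-measurable, the integral of [u + c] is not split directly. Instead
    a minorant [h] of [v] yields [w = max 0 (h / k - c)], a measurable minorant of [u] with
    [h <= k * (w + c)]. *)
Lemma integral_affine_bound_nm (u v : T -> R) (k c : R) : mu setT < +oo ->
  (0 <= k)%R -> (0 <= c)%R -> (forall x, 0 <= u x)%R -> (forall x, 0 <= v x)%R ->
  (forall x, v x <= k * (u x + c))%R ->
  \int[mu]_x (u x)%:E < +oo -> \int[mu]_x (v x)%:E < +oo.
Proof.
move=> muT k0 c0 u0 v0 vu uoo.
apply: (@le_lt_trans _ _ (k%:E * (\int[mu]_x (u x)%:E + c%:E * mu setT))).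
  apply: ge0_integral_le_sup => [x|h mh h0 hv]; first by rewrite lee_fin.
  (* The term [(k == 0)%:R] makes the divisor 1 when [k = 0], a case in which [v], hence [h],
     vanishes. *)
  pose w x := Num.max 0%R (h x / (k + (k == 0)%:R) - c)%R.
  have mw : measurable_fun setT w.
    apply: measurable_maxr => //; apply: measurable_funB => //.
    exact: measurable_funM.
  have wu x : (w x <= u x)%R.
    rewrite /w ge_max u0/= lerBlDr.
    have [k00|kN0] := eqVneq k 0%R.
      have -> : h x = 0%R.
        apply/eqP; rewrite eq_le h0 andbT; have := hv x; rewrite lee_fin.
        by move=> /le_trans -> //; rewrite (le_trans (vu x))// k00 mul0r.
      by rewrite mul0r addr_ge0.
    rewrite addr0 ler_pdivrMr ?lt_neqAle 1?eq_sym ?kN0// mulrC.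
    by apply: le_trans (vu x); have := hv x; rewrite lee_fin.
  have hw x : (h x <= k * (w x + c))%R.
    have [k00|kN0] := eqVneq k 0%R.
      rewrite k00 mul0r; have := hv x; rewrite lee_fin.
      by move=> /le_trans -> //; rewrite (le_trans (vu x))// k00 mul0r.
    rewrite mulrC -ler_pdivrMr ?lt_neqAle 1?eq_sym ?kN0// -lerBlDr.
    by rewrite /w (negbTE kN0) addr0 le_max lexx orbT.
  have w0 x : (0 <= w x)%R by rewrite /w le_max lexx.
  have -> : \int[mu]_x (u x)%:E + c%:E * mu setT =
     \int[mu]_x (u x)%:E + \int[mu]_x c%:E by rewrite integral_cst.
  apply: (@le_trans _ _ (k%:E * \int[mu]_x (w x + c)%:E)).
    rewrite -ge0_integralZl//; last 2 first.
    - exact/measurable_EFinP/measurable_funD.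
    - by move=> x _; rewrite lee_fin addr_ge0.
    by apply: ge0_le_integral_nm => x _; rewrite -?EFinM lee_fin.
  apply: lee_wpmul2l; first by rewrite lee_fin.
  under eq_integral do rewrite EFinD.
  rewrite ge0_integralD//; last 2 first.
  - by move=> x _; rewrite lee_fin.
  - exact/measurable_EFinP.
  by apply: leeD => //; apply: ge0_le_integral_nm => x _; rewrite lee_fin.
rewrite ltey; apply/eqP => E.
have : \int[mu]_x (u x)%:E \is a fin_num.
  by rewrite ge0_fin_numE// integral_ge0// => x _; rewrite lee_fin.
have : mu setT \is a fin_num by rewrite ge0_fin_numE.
by move: E; move: (mu setT) (integral _ _ _) => [a| |] [r| |].
Qed.
End LowerIntegral.

(** * Affine substitutions on the real line *)

Section AffineChange.
Local Open Scope ereal_scope.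
Variables (R : realType) (c b : R).
Hypothesis c0 : c != 0%R.
Local Notation leb := (@lebesgue_measure R).
Let phi : measurableTypeR R -> measurableTypeR R := fun t => (c * t + b)%R.

Let mphi : measurable_fun setT phi.
Proof. by apply: measurable_funD => //; exact: measurable_funM. Qed.

Let pphi := @measure_function_pushforward__canonical__measure_function_Measure _ _ _ _ _ leb phi mphi.

(** The pushforward by [phi] scaled by [|c|] has the right value on half-open intervals, which
    determines Lebesgue measure. A negative [c] exchanges the open end and the closed one, without
    effect on the length. *)
Lemma lebesgue_measure_affine (S : set R) : measurable S ->
  leb (phi @^-1` S) = `|c^-1|%:E * leb S.
Proof.
have nc0 : (0 < `|c|)%R by rewrite normr_gt0.
move=> mS; have -> : leb S = mscale (`|c|%:nng)%R pphi S.
  apply: lebesgue_measure_unique => //= _ [[u v]] _ <-.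
  rewrite /mscale/= /pushforward.
  have : (phi @^-1` `]u, v]%classic = if (0 < c)%R then
      `](u - b) / c, (v - b) / c]%classic else `[(v - b) / c, (u - b) / c[%classic)%R.
    apply/seteqP; split => t; case: ifPn => cP; rewrite /phi /= !in_itv/=.
    - by rewrite ltr_pdivrMr// ler_pdivlMr// ltrBlDr lerBrDr mulrC.
    - have {}cP : (c < 0)%R by rewrite lt_neqAle c0 leNgt.
      by rewrite ler_ndivrMr// ltr_ndivlMr// ltrBlDr lerBrDr mulrC andbC.
    - by rewrite ltr_pdivrMr// ler_pdivlMr// ltrBlDr lerBrDr mulrC.
    - have {}cP : (c < 0)%R by rewrite lt_neqAle c0 leNgt.
      by rewrite ler_ndivrMr// ltr_ndivlMr// ltrBlDr lerBrDr mulrC andbC.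
  move=> ->; rewrite lebesgue_measure_itv /= lte_fin.
  case: (boolP (0 < c)%R) => cP.
    rewrite lebesgue_measure_itv /= !lte_fin ltr_pM2r ?invr_gt0// ltrD2r.
    case: ifPn => uv; last by rewrite mule0.
    rewrite -!EFinB -EFinM; congr EFin; rewrite gtr0_norm//.
    by rewrite -mulrBl mulrCA mulfV// mulr1 opprB addrA subrK.
  have {}cP : (c < 0)%R by rewrite lt_neqAle c0 leNgt.
  rewrite lebesgue_measure_itv /= !lte_fin ltr_nM2r ?invr_lt0// ltrD2r.
  case: ifPn => uv; last by rewrite mule0.
  rewrite -!EFinB -EFinM; congr EFin; rewrite ltr0_norm//.
  rewrite -mulrBl mulrCA mulNr mulfV// mulrN1 !opprB.
  by rewrite addrA subrK.
by rewrite /mscale/= muleA -EFinM normfV mulVf ?mul1e// gt_eqF.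
Qed.

(** A measurable minorant [h] of [g] on [D] moves along the inverse substitution [psi] to
    [|c^-1| * h (psi t)], a minorant of [f] on [E] with the same integral. *)
Lemma ge0_integral_affine_nm (f g : R -> R) (D E : set R) :
  (forall t, 0 <= f t)%R -> (forall t, 0 <= g t)%R ->
  (forall t, D t -> E (phi t)) -> (forall t, D t -> g t <= `|c| * f (phi t))%R ->
  \int[leb]_(t in D) (g t)%:E <= \int[leb]_(t in E) (f t)%:E.
Proof.
move=> f0 g0 DE gf; rewrite integral_mkcond [leRHS]integral_mkcond.
have r0 (u : R -> R) D' t : (forall t, 0 <= u t)%R -> 0 <= ((fun t => (u t)%:E) \_ D') t.
  by move=> u0; rewrite /patch; case: ifP => // _; rewrite lee_fin.
have nc0 : (0 < `|c|)%R by rewrite normr_gt0.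
apply: ge0_integral_le_sup => [t|h mh h0 hf]; first exact: r0.
pose psi : measurableTypeR R -> measurableTypeR R := fun t => ((t - b) / c)%R.
have mpsi : measurable_fun setT psi by apply: measurable_funM => //; exact: measurable_funB.
have psiK t : psi (phi t) = t by rewrite /psi /phi addrK mulrC mulKf.
have phiK t : phi (psi t) = t by rewrite /psi /phi mulrC divfK// subrK.
have mhpsi : measurable_fun setT (EFin \o (h \o psi)).
  by apply/measurable_EFinP; exact: measurableT_comp.
have -> : \int[leb]_t (h t)%:E = \int[pphi]_t (h (psi t))%:E.
  rewrite ge0_integral_pushforward//=; last by move=> t _; rewrite lee_fin.
  by apply: eq_integral => t _; rewrite /= psiK.
have -> : \int[pphi]_t (h (psi t))%:E =
    \int[mscale (`|c^-1|%:nng)%R leb]_t (h (psi t))%:E.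
  by apply: eq_measure_integral => S mS _; exact: lebesgue_measure_affine.
rewrite ge0_integral_mscale//; last by move=> t _; rewrite lee_fin.
rewrite -ge0_integralZl//; last by move=> t _; rewrite lee_fin.
apply: ge0_le_integral_nm => t _; first by rewrite -EFinM lee_fin mulr_ge0.
have := hf (psi t); rewrite {1}/patch; case: ifPn => [/set_mem Dt|_] ht.
  have Et : E t by rewrite -(phiK t); exact: DE.
  rewrite /patch mem_set// -EFinM lee_fin /= normfV mulrC ler_pdivrMr// mulrC.
  by move: ht; rewrite lee_fin => /le_trans -> //; rewrite -{2}(phiK t) gf.
rewrite (_ : h (psi t) = 0%R) ?mule0; first exact: r0.
by apply/eqP; rewrite eq_le h0 andbT -lee_fin.
Qed.

End AffineChange.

(** * Completions of pseudo-metric spaces *)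

Section QuotientTheory.
Variables (T : Type) (E : T -> T -> Prop).
Hypotheses (Er : forall x, E x x) (Es : forall x y, E x y -> E y x)
  (Et : forall x y z, E x y -> E y z -> E x z).

Lemma cls_eq x y : E x y -> cls E x = cls E y.
Proof.
move=> xy; apply: eq_exist => /=; apply/seteqP; split => z Hz.
  by apply: Et Hz; exact: Es.
exact: Et xy Hz.
Qed.

Lemma quotient_cls (S : quotient E) x : sval S x -> S = cls E x.
Proof.
case: S => S [y Sy] /=; subst S => yx.
rewrite -(cls_eq yx); exact: eq_exist.
Qed.

Lemma rep_in (S : quotient E) : sval S (rep S).
Proof.
by rewrite /rep; case: cid => y /= ->; exact: Er.
Qed.

Lemma repK (S : quotient E) : cls E (rep S) = S.
Proof. by rewrite -(quotient_cls (rep_in S)). Qed.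

Lemma rep_cls x : E x (rep (cls E x)).
Proof. exact: rep_in (cls E x). Qed.

End QuotientTheory.

(** Separation is left out: completion identifies asymptotic sequences, so points at distance 0 are
    merged in any case. *)
Record pseudo_metric (R : realType) (X : Type) (d : X -> X -> R) : Prop :=
  PseudoMetric {
    pm_xx : forall x, d x x = 0 ;
    pm_sym : forall x y, d x y = d y x ;
    pm_triangle : forall x y z, d x z <= d x y + d y z }.

Section PseudoMetricTheory.
Variables (R : realType) (X : Type) (d : X -> X -> R).
Hypothesis pm : pseudo_metric d.
Local Notation D := (@completion_dist R X d).
Local Notation asym := (@asymptotic R X d).

Lemma pm_ge0 x y : 0 <= d x y.
Proof.
have := pm_triangle pm x y x; rewrite (pm_xx pm) (pm_sym pm y x) -mulr2n.
by rewrite pmulrn_lge0.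
Qed.

Lemma pm_quad x y x' y' : `|d x y - d x' y'| <= d x x' + d y y'.
Proof.
have H a b a' b' : d a b - d a' b' <= d a a' + d b b'.
  rewrite lerBlDr (le_trans (pm_triangle pm a a' b))// -addrA lerD2l addrC.
  by rewrite (le_trans (pm_triangle pm a' b' b))// (pm_sym pm b' b).
rewrite ler_norml H andbT lerNl opprB.
by rewrite (le_trans (H _ _ _ _))// (pm_sym pm x') (pm_sym pm y').
Qed.

Lemma cauchy_dist_cvg (u v : {u | cauchy_seq d u}) :
  cvgn (fun i => d (sval u i) (sval v i)).
Proof.
apply: cauchy_cvg; apply: cauchy_exP => e e0.
have e2 : 0 < e / 2 by rewrite divr_gt0.
have [N1 H1] := svalP u _ e2; have [N2 H2] := svalP v _ e2.
pose N := maxn N1 N2; exists (d (sval u N) (sval v N)).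
exists N => // i /= Ni; rewrite -ball_normE /ball_/=.
rewrite (le_lt_trans (pm_quad _ _ _ _))// (splitr e) ltrD//.
  by apply: H1; rewrite (leq_trans (leq_maxl N1 N2)).
by apply: H2; rewrite (leq_trans (leq_maxr N1 N2)).
Qed.



Lemma asymptotic_refl u : asym u u.
Proof.
rewrite /asymptotic (_ : (fun i => _) = cst 0); first exact: cvg_cst.
by apply/funext => i; rewrite (pm_xx pm).
Qed.

Lemma asymptotic_sym u v : asym u v -> asym v u.
Proof. by rewrite /asymptotic; under [in X in _ -> X]eq_fun do rewrite (pm_sym pm). Qed.

Lemma asymptotic_trans u v w : asym u v -> asym v w -> asym u w.
Proof.
rewrite /asymptotic => uv vw.
apply: (@squeeze_cvgr _ _ _ _ (cst 0)
  (fun i => d (sval u i) (sval v i) + d (sval v i) (sval w i))).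
- by near=> i; rewrite pm_ge0 (pm_triangle pm).
- exact: cvg_cst.
- by rewrite -(addr0 0); exact: cvgD.
Unshelve. all: by end_near. Qed.

(** [completion_dist] is a limit along representatives picked by choice. The quadrilateral
    inequality [pm_quad] shows that any other representatives have the same limit, which removes the
    choice from later arguments. *)
Lemma completion_dist_cls u v :
  d (sval u i) (sval v i) @[i --> \oo] --> D (cls asym u) (cls asym v).
Proof.
have ur := rep_cls asymptotic_refl u; have vr := rep_cls asymptotic_refl v.
have H : d (sval (rep (cls asym u)) i) (sval (rep (cls asym v)) i)
    @[i --> \oo] --> D (cls asym u) (cls asym v) by exact: cauchy_dist_cvg.
rewrite (_ : (fun i => _) = (fun i => d (sval (rep (cls asym u)) i)
   (sval (rep (cls asym v)) i) + (d (sval u i) (sval v i) -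
   d (sval (rep (cls asym u)) i) (sval (rep (cls asym v)) i)))); last first.
  by apply/funext => i; rewrite addrC subrK.
rewrite -[X in _ --> X]addr0; apply: cvgD => //.
apply/norm_cvg0P.
apply: (@squeeze_cvgr _ _ _ _ (cst 0)
  (fun i => d (sval u i) (sval (rep (cls asym u)) i) +
     d (sval v i) (sval (rep (cls asym v)) i))).
- by near=> i; rewrite normr_ge0 pm_quad.
- exact: cvg_cst.
- by rewrite -(addr0 0); exact: cvgD.
Unshelve. all: by end_near. Qed.

Lemma completion_ind (P : completion d -> Prop) :
  (forall u, P (cls asym u)) -> forall x, P x.
Proof. by move=> Pc [S [u Su]]; subst S; exact: Pc. Qed.

Lemma completion_dist_unique u v (l : R) :
  d (sval u i) (sval v i) @[i --> \oo] --> l -> D (cls asym u) (cls asym v) = l.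
Proof.
by move=> uvl; apply: (cvg_unique (@Rhausdorff R) (@completion_dist_cls u v) uvl).
Qed.

Lemma completion_pseudo_metric : pseudo_metric D.
Proof.
split.
- elim/completion_ind => u; apply: completion_dist_unique.
  exact: asymptotic_refl.
- elim/completion_ind => u; elim/completion_ind => v.
  apply: completion_dist_unique; under eq_fun do rewrite (pm_sym pm).
  exact: completion_dist_cls.
- elim/completion_ind => u; elim/completion_ind => v; elim/completion_ind => w.
  apply: (@ler_cvg_to _ _ _ _ _ _ _ _ (@completion_dist_cls u w)
    (cvgD (@completion_dist_cls u v) (@completion_dist_cls v w))).
  by near=> i; exact: pm_triangle.
Unshelve. all: by end_near. Qed.

Lemma completion_in_dist dxx x y :
  D (completion_in dxx x) (completion_in dxx y) = d x y.
Proof.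
by rewrite (@completion_dist_unique _ _ (d x y))//=; apply: cvg_cst.
Qed.

Lemma completion_dense dxx (z : completion d) e : 0 < e ->
  exists x, D z (completion_in dxx x) < e.
Proof.
move=> e0; elim/completion_ind: z => u.
have e2 : 0 < e / 2 by rewrite divr_gt0.
have [N HN] := svalP u _ e2; exists (sval u N).
apply: (@le_lt_trans _ _ (e / 2)); last by rewrite ltr_pdivrMr// ltr_pMr// ltr1n.
rewrite /completion_in.
apply: (cvgr_to_le (@completion_dist_cls _ _)).
exists N => // i /= Ni; rewrite ltW//.
exact: HN.
Qed.



End PseudoMetricTheory.

Section CompletionMap.
Variables (R : realType) (X Y : Type) (dX : X -> X -> R) (dY : Y -> Y -> R).
Hypotheses (pX : pseudo_metric dX) (pY : pseudo_metric dY).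
Variable f : X -> Y.
Hypothesis fiso : forall x y, dY (f x) (f y) = dX x y.

Lemma cauchy_comp (u : {u | cauchy_seq dX u}) : cauchy_seq dY (f \o sval u).
Proof.
by move=> e /(svalP u)[N HN]; exists N => i j Ni Nj; rewrite /= fiso HN.
Qed.

Definition cauchy_map (u : {u | cauchy_seq dX u}) : {u | cauchy_seq dY u} :=
  exist _ _ (cauchy_comp u).

Definition completion_map (x : completion dX) : completion dY :=
  cls (@asymptotic R Y dY) (cauchy_map (rep x)).

Lemma completion_map_cls u :
  completion_map (cls (@asymptotic R X dX) u) = cls (@asymptotic R Y dY) (cauchy_map u).
Proof.
apply: cls_eq; [exact: asymptotic_sym|exact: asymptotic_trans|].
apply: asymptotic_sym => //; rewrite /asymptotic /=.
under eq_fun do rewrite fiso.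
exact: (rep_cls (asymptotic_refl pX)).
Qed.

Lemma completion_map_dist x y :
  completion_dist (completion_map x) (completion_map y) = completion_dist x y.
Proof.
elim/completion_ind: x => u; elim/completion_ind: y => v.
rewrite !completion_map_cls; apply: completion_dist_unique => //=.
under eq_fun do rewrite fiso.
exact: completion_dist_cls.
Qed.

Lemma completion_map_in xx yy x :
  completion_map (completion_in xx x) = completion_in yy (f x).
Proof. by rewrite completion_map_cls; congr cls; exact: eq_exist. Qed.

(** The bundle topology is phrased with a relation between representatives; as a class is determined
    by any of its members, this relation is a function. *)
Lemma completion_map_graphP x y :
  completion_map_graph f x y <-> y = completion_map x.
Proof.
split=> [[u [v [xu yv vfu]]]|->].
  rewrite (quotient_cls (asymptotic_sym pX) (@asymptotic_trans _ _ _ pX) xu).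
  rewrite (quotient_cls (asymptotic_sym pY) (@asymptotic_trans _ _ _ pY) yv).
  rewrite completion_map_cls; congr cls.
  by case: v vfu {yv} => v cv /= vfu; apply: eq_exist; exact/funext.
exists (rep x), (cauchy_map (rep x)); split=> //.
  exact: rep_in (asymptotic_refl pX) x.
exact: asymptotic_refl.
Qed.

End CompletionMap.

Lemma completion_map_comp (R : realType) (X Y Z : Type) (dX : X -> X -> R)
    (dY : Y -> Y -> R) (dZ : Z -> Z -> R) (pX : pseudo_metric dX)
    (pY : pseudo_metric dY) (pZ : pseudo_metric dZ)
    (f : X -> Y) (g : Y -> Z) (h : X -> Z)
    (fiso : forall x y, dY (f x) (f y) = dX x y)
    (giso : forall x y, dZ (g x) (g y) = dY x y)
    (hiso : forall x y, dZ (h x) (h y) = dX x y) :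
  (forall x, h x = g (f x)) ->
  forall x, completion_map hiso x = completion_map giso (completion_map fiso x).
Proof.
move=> hgf; elim/completion_ind => u; rewrite !completion_map_cls//.
by congr cls; apply: eq_exist; apply/funext => i /=.
Qed.

Lemma completion_map_id (R : realType) (X : Type) (d : X -> X -> R)
    (pm : pseudo_metric d) (f : X -> X)
    (fiso : forall x y, d (f x) (f y) = d x y) :
  (forall x, f x = x) -> forall x, completion_map fiso x = x.
Proof.
move=> fid; elim/completion_ind => u; rewrite !completion_map_cls//.
by congr cls; case: u => u cu; apply: eq_exist; apply/funext => i /=.
Qed.

(** Functoriality, applied to [f] and its inverse, which also preserves distances. *)
Lemma completion_map_bij (R : realType) (X Y : Type) (dX : X -> X -> R)
    (dY : Y -> Y -> R) (pX : pseudo_metric dX) (pY : pseudo_metric dY)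
    (f : X -> Y) (fiso : forall x y, dY (f x) (f y) = dX x y) :
  bijective f -> bijective (completion_map fiso).
Proof.
move=> [g fK gK]; have giso x y : dX (g x) (g y) = dY x y by rewrite -fiso !gK.
exists (completion_map giso) => x.
  rewrite -(@completion_map_comp _ _ _ _ _ _ _ pX pY pX f g id fiso giso) => //.
  exact: completion_map_id.
rewrite -(@completion_map_comp _ _ _ _ _ _ _ pY pX pY g f id giso fiso) => //.
exact: completion_map_id.
Qed.

(** * Calculus of matrix-valued functions *)

Section MatrixLimits.
Variables (R : realType) (T : Type) (F : set_system T).
Context {FF : ProperFilter F}.

Lemma cvg_mxP m n (f : T -> 'M[R]_(m, n)) (B : 'M[R]_(m, n)) :
  f x @[x --> F] --> B <-> forall i j, f x i j @[x --> F] --> B i j.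
Proof.
split=> [fB i j|fB].
  exact: (@cvg_comp _ _ _ f (fun C : 'M[R]_(m, n) => C i j) _ _ _ fB
            (@coord_continuous R m n i j B)).
apply/cvgrPdist_le => e e0; near=> x.
rewrite /Num.Def.normr/= mx_normrE (bigmax_le _ (ltW e0))//= => i _.
rewrite !mxE/=; move: i; near: x; apply: filter_forall => /= i.
exact: ((cvgrPdist_le _ _).1 (fB i.1 i.2)).
Unshelve. all: by end_near. Qed.

Let cvg_sum_seq (I : Type) (r : seq I) (f : I -> T -> R) (l : I -> R) :
  (forall i, f i x @[x --> F] --> l i) ->
  (\sum_(i <- r) f i x) @[x --> F] --> \sum_(i <- r) l i.
Proof.
move=> fl; elim: r => [|i r IH].
  by under eq_fun do rewrite big_nil; rewrite big_nil; apply: cvg_cst.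
by under eq_fun do rewrite big_cons; rewrite big_cons; apply: cvgD.
Qed.

Let cvg_prod_seq (I : Type) (r : seq I) (f : I -> T -> R) (l : I -> R) :
  (forall i, f i x @[x --> F] --> l i) ->
  (\prod_(i <- r) f i x) @[x --> F] --> \prod_(i <- r) l i.
Proof.
move=> fl; elim: r => [|i r IH].
  by under eq_fun do rewrite big_nil; rewrite big_nil; apply: cvg_cst.
by under eq_fun do rewrite big_cons; rewrite big_cons; apply: cvgM.
Qed.

Lemma cvg_mulmx m n p (f : T -> 'M[R]_(m, n)) (g : T -> 'M[R]_(n, p))
    (B : 'M[R]_(m, n)) (C : 'M[R]_(n, p)) :
  f x @[x --> F] --> B -> g x @[x --> F] --> C ->
  (f x *m g x) @[x --> F] --> B *m C.
Proof.
move=> /cvg_mxP fB /cvg_mxP gC; apply/cvg_mxP => i j; rewrite mxE.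
under eq_fun do rewrite mxE.
by apply: cvg_sum_seq => k; apply: cvgM.
Qed.

Lemma cvg_trmx m n (f : T -> 'M[R]_(m, n)) (B : 'M[R]_(m, n)) :
  f x @[x --> F] --> B -> (f x)^T @[x --> F] --> B^T.
Proof.
move=> /cvg_mxP fB; apply/cvg_mxP => i j; rewrite mxE.
by under eq_fun do rewrite mxE; exact: fB.
Qed.

Lemma cvg_mxtrace n (f : T -> 'M[R]_n) (B : 'M[R]_n) :
  f x @[x --> F] --> B -> \tr (f x) @[x --> F] --> \tr B.
Proof. by move=> /cvg_mxP fB; apply: cvg_sum_seq => i; exact: fB. Qed.

Lemma cvg_det n (f : T -> 'M[R]_n) (B : 'M[R]_n) :
  f x @[x --> F] --> B -> \det (f x) @[x --> F] --> \det B.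
Proof.
move=> /cvg_mxP fB; apply: cvg_sum_seq => s; apply: cvgM; first by apply: cvg_cst.
by apply: cvg_prod_seq => i; exact: fB.
Qed.

(** [invmx] follows the adjugate formula on invertible matrices only; the determinant stays nonzero
    near the limit, so the formula holds eventually. *)
Lemma cvg_invmx n (f : T -> 'M[R]_n) (B : 'M[R]_n) : B \in unitmx ->
  f x @[x --> F] --> B -> invmx (f x) @[x --> F] --> invmx B.
Proof.
move=> uB fB; have dB : \det B != 0 by rewrite -unitfE -unitmxE.
have dfB := cvg_det fB.
have : (\det (f x))^-1 *: \adj (f x) @[x --> F] --> invmx B.
  rewrite /invmx uB; apply: cvgZ; first exact: cvgV.
  apply/cvg_mxP => i j; rewrite mxE; under eq_fun do rewrite mxE.
  apply: cvgM; first by apply: cvg_cst.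
  apply: cvg_det; apply/cvg_mxP => k l; rewrite !mxE.
  by under eq_fun do rewrite !mxE; move/cvg_mxP : fB; exact.
apply: cvg_trans; apply: near_eq_cvg; near=> x.
rewrite /invmx ifT// unitmxE unitfE; near: x.
exact: (cvgr_neq0 _ dfB dB).
Unshelve. all: by end_near. Qed.

End MatrixLimits.

Section DeriveCurves.
Variables (R : realType) (m n : nat).
Implicit Type f : R -> 'M[R]_(m, n).


Lemma derivable_affine f (c b t : R) : derivable f (c * t + b) 1 ->
  derivable (fun s => f (c * s + b)) t 1 /\
  derive1 (fun s => f (c * s + b)) t = c *: derive1 f (c * t + b).
Proof.
move=> /derivable1_diffP df; pose phi : R -> R := ( *:%R c : R -> R) + cst b.
have dphi := is_diffD (is_diff_scaler c t) (is_diff_cst b t).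
have dfphi : differentiable (f \o phi) t by apply: differentiable_comp.
split; first exact/derivable1_diffP.
rewrite derive1E' // (_ : (fun _ => _) = f \o phi)// diff_comp//=.
have -> : 'd phi t 1 = c *: (1 : R) by rewrite diff_val /= /GRing.add/= addr0.
by rewrite linearZ derive1E'.
Qed.

(* The limit of a divergent difference quotient is the junk value 0.  This makes
   derive1_affine and derive1_congr hold at the corners of a curve too. *)
Lemma derive1_ndiff f t : ~ derivable f t 1 -> derive1 f t = 0.
Proof.
by move=> ndf; rewrite derive1E /derive dvgP//; apply/matrixP => i j; rewrite !mxE.
Qed.

Lemma derive1_affine f (c b t : R) : c != 0 ->
  derive1 (fun s => f (c * s + b)) t = c *: derive1 f (c * t + b).
Proof.
move=> c0; have [df|ndf] := pselect (derivable f (c * t + b) 1).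
  by have [] := derivable_affine df.
rewrite (derive1_ndiff ndf) scaler0; apply: derive1_ndiff => df; apply: ndf.
have [] := @derivable_affine (fun s => f (c * s + b)) c^-1 (- (b / c)) (c * t + b).
  have -> : c^-1 * (c * t + b) - b / c = t by rewrite mulrDr mulKf// [c^-1 * b]mulrC addrK.
  exact: df.
suff -> : (fun s => f (c * (c^-1 * s - b / c) + b)) = f by [].
apply/funext => s; rewrite mulrBr mulrA mulfV// mul1r.
by rewrite [c * _]mulrC divfK// subrK.
Qed.

End DeriveCurves.

Section DeriveCongr.
Variables (R : realType) (n : nat).
Implicit Type f : R -> 'M[R]_n.

Lemma continuous_congr (J : 'M[R]_n) :
  continuous (fun B : 'M[R]_n => J *m B *m J^T).
Proof.
move=> B; apply: (@cvg_mulmx _ _ (nbhs B) _ _ _ _ _ (fun=> J^T)).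
  by apply: (@cvg_mulmx _ _ (nbhs B) _ _ _ _ (fun=> J) id); [apply: cvg_cst|apply: cvg_id].
by apply: cvg_cst.
Qed.

Let derivable_congr (J : 'M[R]_n) f t : derivable f t 1 ->
  derivable (fun s => J *m f s *m J^T) t 1 /\
  derive1 (fun s => J *m f s *m J^T) t = J *m derive1 f t *m J^T.
Proof.
move=> /derivable1_diffP df.
pose L : {linear 'M[R]_n -> 'M[R]_n} := mulmxr J^T \o mulmx J.
have cL : continuous L by exact: continuous_congr.
have dL x : differentiable L x by exact: linear_differentiable.
have dfL : differentiable (L \o f) t by apply: differentiable_comp.
split; first exact/derivable1_diffP.
by rewrite derive1E' // (_ : (fun _ => _) = L \o f)// diff_comp//= diff_lin// derive1E'.
Qed.

Lemma derive1_congr (J K : 'M[R]_n) f t :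
  K *m J = 1%:M ->
  derive1 (fun s => J *m f s *m J^T) t = J *m derive1 f t *m J^T.
Proof.
move=> KJ; have [df|ndf] := pselect (derivable f t 1).
  by have [] := derivable_congr J df.
rewrite (derive1_ndiff ndf) mulmx0 mul0mx.
apply: derive1_ndiff => df; apply: ndf.
have [] := derivable_congr K df.
suff -> : (fun s => K *m (J *m f s *m J^T) *m K^T) = f by [].
apply/funext => s; rewrite !mulmxA KJ mul1mx -mulmxA -trmx_mul KJ.
by rewrite trmx1 mulmx1.
Qed.

Lemma C1_congr (J : 'M[R]_n) f : C1 f -> C1 (fun s => J *m f s *m J^T).
Proof.
move=> [df cf]; split=> [t|]; first by have [] := derivable_congr J (df t).
have -> : derive1 (fun s => J *m f s *m J^T) = (fun s => J *m derive1 f s *m J^T).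
  by apply/funext => t; have [] := derivable_congr J (df t).
move=> t; apply: (@continuous_comp _ _ _ (derive1 f) (fun B => J *m B *m J^T) t).
  exact: cf.
exact: continuous_congr.
Qed.

Lemma C1_affine f (c b : R) : C1 f -> C1 (fun s => f (c * s + b)).
Proof.
move=> [df cf]; split=> [t|].
  by have [] := @derivable_affine _ _ _ f c b t (df (c * t + b)).
have -> : derive1 (fun s => f (c * s + b)) = (fun s => c *: derive1 f (c * s + b)).
  by apply/funext => t; have [] := @derivable_affine _ _ _ f c b t (df (c * t + b)).
move=> t; apply: cvgZ; first by apply: cvg_cst.
apply: (@continuous_comp _ _ _ (fun s => c * s + b) (derive1 f) t); last exact: cf.
by apply: cvgD; [apply: cvgM; [apply: cvg_cst|apply: cvg_id]|apply: cvg_cst].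
Qed.

Let is_diff_segment (B D : 'M[R]_n) (t : R) :
  is_diff t (fun s => B + s *: D) (fun s => s *: D).
Proof.
have H := is_diffD (is_diff_cst B t) (is_diff_scalel t D).
by apply: (is_diff_eq H); apply/funext => s; rewrite /GRing.add/= add0r.
Qed.

Lemma derive1_segment (B D : 'M[R]_n) t : derive1 (fun s => B + s *: D) t = D.
Proof.
have H := is_diff_segment B D t; rewrite derive1E'; last exact: ex_diff.
by case: H => _ ->; rewrite scale1r.
Qed.

Lemma C1_segment (B D : 'M[R]_n) : C1 (fun s => B + s *: D).
Proof.
split=> [t|].
  by have H := is_diff_segment B D t; apply/derivable1_diffP; exact: ex_diff.
have -> : derive1 (fun s => B + s *: D) = cst D.
  by apply/funext => t; exact: derive1_segment.
exact: cst_continuous.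
Qed.

End DeriveCongr.

(** * Riemannian distances *)

Section C1Pieces.
Variables (R : realType) (n : nat).
Implicit Types (f : R -> 'M[R]_n) (p : seq R).

(** As a relation between consecutive breakpoints, so that a subdivision becomes a [path] and can be
    mapped, reversed and concatenated with the list lemmas. *)
Definition C1_piece f : rel R := fun x y =>
  `[< x < y /\ exists2 phi, C1 phi & forall t, x <= t <= y -> f t = phi t >].

Lemma piecewise_C1P (X : Type) (crd : X -> 'M[R]_n) (g : R -> X) :
  piecewise_C1 crd g <-> exists s, path (C1_piece (crd \o g)) 0 (rcons s 1).
Proof.
split=> [[s ps Hs]|[s /(pathP 0) Hs]].
  exists s; apply/(pathP 0) => i; rewrite size_rcons ltnS => si.
  apply/asboolP; split; last exact: Hs.
  by move/(pathP 0) : ps; apply; rewrite size_rcons ltnS.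
exists s.
  by apply/(pathP 0) => i /Hs/asboolP[].
by move=> i si; have := Hs i; rewrite size_rcons ltnS => /(_ si)/asboolP[].
Qed.

Lemma path_C1_le f a p : path (C1_piece f) a p -> a <= last a p.
Proof.
elim: p a => //= x p IH a /andP[/asboolP[ax _] /IH].
exact/le_trans/ltW.
Qed.

Lemma path_C1_eq f f' a p : path (C1_piece f) a p ->
  (forall t, a <= t <= last a p -> f t = f' t) -> path (C1_piece f') a p.
Proof.
elim: p a => //= x p IH a /andP[/asboolP[ax [phi cphi fphi]] px] ff'.
apply/andP; split; last first.
  by apply: IH => // t /andP[xt tl]; apply: ff'; rewrite tl andbT (le_trans (ltW ax)).
apply/asboolP; split=> //; exists phi => // t /andP[at_ tx].
by rewrite -ff' ?fphi ?at_ ?tx// (le_trans tx)// (path_C1_le px).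
Qed.

Lemma path_C1_affine f a p (c b : R) : 0 < c -> path (C1_piece f) a p ->
  path (C1_piece (fun t => f (c * t + b))) ((a - b) / c) [seq (x - b) / c | x <- p].
Proof.
move=> c0; rewrite (@path_map _ _ (fun x => (x - b) / c) _ a p); apply: sub_path => x y /asboolP[xy [phi cphi fphi]].
apply/asboolP; split; first by rewrite ltr_pM2r ?invr_gt0// ltrD2r.
exists (fun t => phi (c * t + b)); first exact: C1_affine.
move=> t; rewrite ler_pdivrMr// ler_pdivlMr// lerBlDr lerBrDr mulrC.
exact: fphi.
Qed.

(** Under reversal the last breakpoint becomes the starting point and [a] the final one, hence
    [belast]. *)
Lemma path_C1_rev f a p : path (C1_piece f) a p ->
  path (C1_piece (fun t => f (1 - t))) (1 - last a p) [seq 1 - x | x <- rev (belast a p)].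
Proof.
move=> pf; rewrite (@path_map _ _ (fun x => 1 - x)) rev_path; apply: sub_path pf => x y.
move=> /asboolP[xy [phi cphi fphi]]; apply/asboolP => /=; split.
  by rewrite ltrD2l ltrN2.
exists (fun t => phi (-1 * t + 1)); first exact: C1_affine.
move=> t /andP[yt tx]; rewrite mulN1r [- t + 1]addrC fphi//.
by rewrite lerBrDl -lerBrDr tx/= lerBlDl -lerBlDr.
Qed.

End C1Pieces.

Section RiemannianPseudoMetric.
Variables (R : realType) (n : nat) (X : Type) (crd : X -> 'M[R]_n).
Variable metric : X -> 'M[R]_n -> 'M[R]_n -> R.
Local Notation d := (riemannian_dist crd metric).
Local Notation leb := (@lebesgue_measure R).

Definition speed (g : R -> X) (t : R) : R :=
  Num.sqrt (metric (g t) (derive1 (crd \o g) t) (derive1 (crd \o g) t)).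

Hypothesis metricZ : forall x k a, metric x (k *: a) (k *: a) = k ^+ 2 * metric x a a.
Hypothesis speed_bounded : forall g, piecewise_C1 crd g ->
  exists C, forall t, 0 <= t <= 1 -> speed g t <= C.
Hypothesis joined : forall x y, exists g, [/\ piecewise_C1 crd g, g 0 = x & g 1 = y].

Let elen g : \bar R := (\int[leb]_(t in `[0%R, 1%R]) (speed g t)%:E)%E.

Lemma speed_ge0 g t : 0 <= speed g t. Proof. exact: sqrtr_ge0. Qed.

Lemma curve_length_ge0 g : 0 <= curve_length crd metric g.
Proof. by apply: Rintegral_ge0 => t _; exact: sqrtr_ge0. Qed.

Let elen_ge0 g : (0 <= elen g)%E.
Proof. by apply: integral_ge0 => t _; rewrite lee_fin speed_ge0. Qed.

(* The endpoints are left out because a curve defined on [0, 1] may have a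
   corner there as a function on the real line. *)
Let elen_le g C : (forall t, 0 < t < 1 -> speed g t <= C) -> (elen g <= C%:E)%E.
Proof.
move=> gC; have C0 : 0 <= C.
  by apply: le_trans (gC 2^-1 _); rewrite ?speed_ge0// invr_gt0 ltr0n invf_lt1 ?ltr1n.
have s0 t : (0 <= (speed g t)%:E)%E by rewrite lee_fin speed_ge0.
apply: (@le_trans _ _ (\int[leb]_(t in `]0%R, 1%R[) (speed g t)%:E +
    \int[leb]_(t in [set 0%R] `|` [set 1%R]) (speed g t)%:E)%E).
  apply: integral_setU_le_nm => //.
    exact: measurableU.
  move=> t /=; rewrite !in_itv/= => /andP[]; rewrite !le_eqVlt.
  by move=> /predU1P[<-|t0] /predU1P[->|t1]; [right; left|right; left|right; right|left; rewrite t0].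
apply: (@le_trans _ _ (\int[leb]_(t in `]0%R, 1%R[) C%:E + 0)%E).
  apply: leeD.
    by apply: ge0_le_integral_nm => //= t; rewrite in_itv/= lee_fin => /gC.
  apply: le_trans (@integral_setU_le_nm _ _ _ leb _ [set 0%R] [set 1%R] _ _ _ _ _) _ => //.
  by rewrite !integral_set1 adde0.
by rewrite adde0 integral_cst//= lebesgue_measure_itv/= lte_fin ltr01 oppr0 adde0 mule1.
Qed.

(** [Rintegral] sends an infinite integral to 0, which would give such a curve length 0; the bound
    on the speed excludes this. *)
Let curve_lengthE g : piecewise_C1 crd g -> (curve_length crd metric g)%:E = elen g.
Proof.
move=> /speed_bounded[C gC]; rewrite /curve_length /Rintegral fineK//.
rewrite ge0_fin_numE; last exact: elen_ge0.
apply: le_lt_trans (elen_le (C := C) _) (ltry _) => t /andP[t0 t1].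
by apply: gC; rewrite !ltW.
Qed.

Lemma curve_length_le g C : piecewise_C1 crd g ->
  (forall t, 0 < t < 1 -> speed g t <= C) -> curve_length crd metric g <= C.
Proof. by move=> pg gC; rewrite -lee_fin curve_lengthE// elen_le. Qed.

Let le_curve_length g h : piecewise_C1 crd g -> piecewise_C1 crd h ->
  (elen h <= elen g)%E -> curve_length crd metric h <= curve_length crd metric g.
Proof.
move=> pg ph; move: (curve_lengthE pg) (curve_lengthE ph).
generalize (curve_length crd metric g) (curve_length crd metric h) (elen g) (elen h).
by move=> lg lh eg eh <- <-; rewrite lee_fin.
Qed.

Let le_curve_length2 g1 g2 h : piecewise_C1 crd g1 -> piecewise_C1 crd g2 ->
  piecewise_C1 crd h -> (elen h <= elen g1 + elen g2)%E ->
  curve_length crd metric h <= curve_length crd metric g1 + curve_length crd metric g2.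
Proof.
move=> pg1 pg2 ph.
move: (curve_lengthE pg1) (curve_lengthE pg2) (curve_lengthE ph).
generalize (curve_length crd metric g1) (curve_length crd metric g2)
  (curve_length crd metric h) (elen g1) (elen g2) (elen h).
by move=> l1 l2 lh e1 e2 eh <- <- <-; rewrite -EFinD lee_fin.
Qed.

Let lengths x y := [set curve_length crd metric g | g in
    [set g : R -> X | [/\ piecewise_C1 crd g, g 0 = x & g 1 = y]]].

Let lengths_lb x y : lbound (lengths x y) 0.
Proof. by move=> _ [g _ <-]; exact: curve_length_ge0. Qed.

Let lengths_neq0 x y : lengths x y !=set0.
Proof. by have [g gP] := joined x y; exists (curve_length crd metric g), g. Qed.

Lemma riemannian_dist_le g x y : piecewise_C1 crd g -> g 0 = x -> g 1 = y ->
  d x y <= curve_length crd metric g.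
Proof.
by move=> pg g0 g1; apply: ge_inf; [exists 0; exact: lengths_lb|exists g].
Qed.

(** Joinability of points enters here: the infimum of an empty set of lengths would be the default
    value 0. *)
Let le_riemannian_dist x y l :
  (forall g, piecewise_C1 crd g -> g 0 = x -> g 1 = y -> l <= curve_length crd metric g) ->
  l <= d x y.
Proof.
move=> lg; apply: lb_le_inf; first exact: lengths_neq0.
by move=> _ [g [pg g0 g1] <-]; exact: lg.
Qed.

Let speed_affine g h (c b t : R) : c != 0 ->
  (\forall s \near t, h s = g (c * s + b)) -> speed h t = `|c| * speed g (c * t + b).
Proof.
move=> c0 hg; rewrite /speed.
have -> : derive1 (crd \o h) t = c *: derive1 (crd \o g) (c * t + b).
  rewrite -(derive1_affine _ _ _ c0) !derive1E; apply: near_eq_derive.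
  by apply: filterS hg => s /= ->.
by rewrite metricZ (nbhs_singleton hg) sqrtrM ?sqr_ge0// sqrtr_sqr.
Qed.

Let dist_sym x y : d x y <= d y x.
Proof.
apply: le_riemannian_dist => g pg g0 g1.
pose h t := g (1 - t).
have ph : piecewise_C1 crd h.
  move/piecewise_C1P : pg => [s /path_C1_rev]; rewrite last_rcons belast_rcons.
  rewrite rev_cons map_rcons subrr subr0 => ps.
  by apply/piecewise_C1P; exists [seq 1 - x | x <- rev s].
have h0 : h 0 = x by rewrite /h subr0.
have h1 : h 1 = y by rewrite /h subrr.
apply: le_trans (riemannian_dist_le ph h0 h1) _.
apply: (le_curve_length pg ph).
have N10 : -1 != 0 :> R by rewrite oppr_eq0 oner_eq0.
apply: (ge0_integral_affine_nm (b := 1) N10) => [t|t|t|t _]; try exact: speed_ge0.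
  by rewrite /= !in_itv/= mulN1r => /andP[t0 t1]; rewrite addrC subr_ge0 t1 gerBl.
have hg : \forall s \near t, h s = g (-1 * s + 1).
  by near=> s; rewrite /h mulN1r addrC.
by rewrite (speed_affine N10 hg).
Unshelve. all: by end_near. Qed.

Let dist_triangle x y z : d x z <= d x y + d y z.
Proof.
rewrite -lerBlDr; apply: le_riemannian_dist => g1 pg1 g10 g11.
rewrite lerBlDr -lerBlDl; apply: le_riemannian_dist => g2 pg2 g20 g21.
rewrite lerBlDl.
(* The two curves are run one after the other at double speed, written in the form [c * t + b] of
   the substitution lemmas. *)
pose h t := if t <= 2^-1 then g1 (2 * t + 0) else g2 (2 * t + -1).
have p20 : 0 < 2 :> R by [].
have n20 : 2 != 0 :> R by [].
have h21 : 2 * 2^-1 = 1 :> R by rewrite mulfV.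
have hE2 t : 2^-1 <= t -> h t = g2 (2 * t + -1).
  rewrite /h le_eqVlt => /predU1P[<-|ht]; first by rewrite lexx h21 addr0 subrr g11 g20.
  by rewrite leNgt ht.
have ph : piecewise_C1 crd h.
  move/piecewise_C1P : pg1 => [s1 /(path_C1_affine 0 p20)].
  move/piecewise_C1P : pg2 => [s2 /(path_C1_affine (-1) p20)].
  rewrite !map_rcons; set s2' := map _ _; set s1' := map _ _.
  rewrite !opprK subr0 add0r subr0 mul0r div1r divff// => p2 p1.
  apply/piecewise_C1P; exists (rcons s1' 2^-1 ++ s2').
  rewrite rcons_cat cat_path last_rcons; apply/andP; split.
    by apply: path_C1_eq p1 _ => t; rewrite last_rcons /= /h => /andP[_ ->].
  by apply: path_C1_eq p2 _ => t; rewrite last_rcons /= => /andP[/hE2 ->].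
have h0 : h 0 = x by rewrite /h invr_ge0 ler0n mulr0 addr0.
have h1 : h 1 = z by rewrite hE2 ?invf_le1 ?ler1n// mulr1 addrK.
apply: le_trans (riemannian_dist_le ph h0 h1) _.
apply: (le_curve_length2 pg1 pg2 ph).
have s0 g t : (0 <= (speed g t)%:E)%E by rewrite lee_fin speed_ge0.
apply: (@le_trans _ _ (\int[leb]_(t in `[0%R, (2^-1)%R[) (speed h t)%:E +
    \int[leb]_(t in `[(2^-1)%R, 1%R]) (speed h t)%:E)%E).
  apply: integral_setU_le_nm => // t /=; rewrite !in_itv/= => /andP[t0 t1].
  by case: (ltP t 2^-1) => ht; [left; rewrite t0|right].
apply: leeD.
  apply: (ge0_integral_affine_nm (c := 2) (b := 0)) => // [t|t|t|t]; try exact: speed_ge0.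
    rewrite /= !in_itv/= addr0 => /andP[t0 t1]; rewrite mulr_ge0//=.
    by rewrite -[leRHS]h21 ler_pM2l// ltW.
  rewrite /= in_itv/= => /andP[t0 t1].
  suff hg : \forall s \near t, h s = g1 (2 * s + 0) by rewrite (speed_affine n20 hg).
  by near=> s; rewrite /h ifT// ltW//; near: s; apply: lt_nbhsl.
(* At 1/2 the curve [h] may have a corner, so this point is split off as a null set. At all other
   points of [[0, 1]], ends included, [h] agrees on a neighbourhood with one of the two
   reparametrized curves. *)
apply: (@le_trans _ _ (\int[leb]_(t in [set (2^-1)%R]) (speed h t)%:E +
    \int[leb]_(t in `](2^-1)%R, 1%R]) (speed h t)%:E)%E).
  apply: integral_setU_le_nm => // t /=; rewrite !in_itv/= le_eqVlt.
  by move=> /andP[/predU1P[<-|ht] t1]; [left|right; rewrite ht].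
rewrite integral_set1 add0e.
apply: (ge0_integral_affine_nm (c := 2) (b := -1)) => // [t|t|t|t]; try exact: speed_ge0.
  rewrite /= !in_itv/= => /andP[t0 t1].
  rewrite subr_ge0 -[X in X <= 2 * t]h21 ler_pM2l// ltW//=.
  by rewrite lerBlDr -[leRHS]/(2 : R) ler_piMr.
rewrite /= in_itv/= => /andP[t0 t1].
suff hg : \forall s \near t, h s = g2 (2 * s + -1) by rewrite (speed_affine n20 hg).
by near=> s; rewrite hE2// ltW//; near: s; exact: (cvgr_gt _ (@cvg_id _ (nbhs t))).
Unshelve. all: by end_near. Qed.

Lemma riemannian_pseudo_metric : pseudo_metric d.
Proof.
split=> [x|x y|]; last exact: dist_triangle.
  apply: riemannian_distxx => {}x.
  by rewrite -(scale0r 0) metricZ expr2 !mul0r.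
by apply/eqP; rewrite eq_le !dist_sym.
Qed.

End RiemannianPseudoMetric.

(** * The model fiber *)

Section PosDef.
Variables (R : realType) (n : nat).
Implicit Types H J : 'M[R]_n.

Lemma posdef_unit H : posdef H -> H \in unitmx.
Proof.
move=> [_ pH]; rewrite -row_free_unit -kermx_eq0; apply/rowV0P => v.
move=> /sub_kermxP vH; apply/eqP; apply: contraT => /pH.
by rewrite vH mul0mx mxE ltxx.
Qed.

Lemma posdef_congr J H : J \in unitmx -> posdef H -> posdef (J *m H *m J^T).
Proof.
move=> uJ [sH pH]; split; first by rewrite !trmx_mul trmxK sH mulmxA.
move=> v v0; have : v *m J != 0.
  by apply: contra v0 => /eqP vJ; rewrite -(mulmxK uJ v) vJ mul0mx.
by move=> /pH; rewrite trmx_mul !mulmxA.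
Qed.

Lemma posdef1 : posdef (1%:M : 'M[R]_n).
Proof.
split=> [|v v0]; first by rewrite trmx1.
rewrite mulmx1 mxE; under eq_bigr do rewrite mxE -expr2.
have [i vi] : exists i, v 0 i != 0.
  apply/existsP; rewrite -[X in is_true X]negbK negb_exists; apply: contra v0.
  by move=> /forallP v0; apply/eqP/rowP => i; rewrite mxE; apply/eqP; rewrite -[_ == _]negbK.
rewrite (bigD1 i)//= ltr_pwDl//; first by rewrite lt_neqAle sqr_ge0 eq_sym sqrf_eq0 vi.
by apply: sumr_ge0 => j _; exact: sqr_ge0.
Qed.

Lemma posdef_convex H K (t : R) : 0 <= t <= 1 -> posdef H -> posdef K ->
  posdef (H + t *: (K - H)).
Proof.
move=> /andP[t0 t1] [sH pH] [sK pK]; split.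
  by rewrite linearD linearZ linearB/= sH sK.
move=> v v0; have {}pH := pH v v0; have {}pK := pK v v0.
have -> : H + t *: (K - H) = (1 - t) *: H + t *: K.
  by rewrite scalerBr scalerBl scale1r addrA addrAC.
rewrite mulmxDr mulmxDl -!scalemxAr -!scalemxAl !mxE.
move: pH pK; rewrite !mxE.
set a := (X in 0 < X -> _); set b := (X in _ -> 0 < X -> _) => a0 b0.
have [t_eq1|tlt1] := eqVneq t 1; first by rewrite t_eq1 subrr mul0r add0r mul1r.
rewrite ltr_pwDl// ?mulr_ge0// ?mulr_gt0// ?(ltW b0)// subr_gt0 lt_neqAle.
by rewrite tlt1.
Qed.

(** Joint continuity of the norm in the base point and the tangent vector. *)
Lemma cvg_ebin (T : Type) (F : set_system T) {FF : ProperFilter F}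
    (h a : T -> 'M[R]_n) H B : H \in unitmx ->
  h x @[x --> F] --> H -> a x @[x --> F] --> B ->
  (Num.sqrt (\tr (invmx (h x) *m a x *m invmx (h x) *m a x) * Num.sqrt (\det (h x))))
    @[x --> F] --> Num.sqrt (\tr (invmx H *m B *m invmx H *m B) * Num.sqrt (\det H)).
Proof.
move=> uH hH aB.
have ih : invmx (h x) @[x --> F] --> invmx H by exact: cvg_invmx.
apply: continuous_cvg; first exact: sqrt_continuous.
apply: cvgM.
  apply: cvg_mxtrace; apply: cvg_mulmx (aB); apply: cvg_mulmx (ih).
  exact: cvg_mulmx ih aB.
by apply: continuous_cvg; [exact: sqrt_continuous|exact: cvg_det].
Qed.

Local Notation spdR := (spd R n).

Lemma spd_eq (H K : spdR) : sval H = sval K -> H = K.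
Proof. by case: H K => [H pH] [K pK]; exact: eq_exist. Qed.

Let crd (H : spdR) : 'M[R]_n := sval H.
Let met := @spd_metric R n.

Lemma spd_metricZ (H : spdR) k a : met H (k *: a) (k *: a) = k ^+ 2 * met H a a.
Proof.
rewrite /met /spd_metric mulrA; congr (_ * _).
by rewrite -!(scalemxAr, scalemxAl) scalerA mxtraceZ expr2.
Qed.

(** Inside a piece the speed is that of the C^1 function [phi], which attains a maximum on the
    closed piece. At a breakpoint the derivative of the curve may differ from that of [phi], so the
    speed there enters the bound as a separate term. *)
Lemma spd_speed_bounded (g : R -> spdR) : piecewise_C1 crd g ->
  exists C, forall t, 0 <= t <= 1 -> speed crd met g t <= C.
Proof.
move=> /piecewise_C1P[s]; set a : R := 0; set p := rcons s 1 => pp.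
have -> : 1 = last a p :> R by rewrite last_rcons.
move: (p) (a) pp => {}p {}a; elim: p a => [a _|b p IH a].
  exists (speed crd met g a) => t; rewrite /= -eq_le => /eqP <-.
  by [].
move=> /= /andP[/asboolP[ab [phi cphi gphi]] /IH[C HC]].
pose w (t : R) := Num.sqrt (\tr (invmx (phi t) *m derive1 phi t *m invmx (phi t) *m derive1 phi t)
  * Num.sqrt (\det (phi t))).
have [c _ Hc] : exists2 c, c \in `[a, b] & forall t, t \in `[a, b] -> w t <= w c.
  apply: EVT_max; first exact: ltW.
  apply: continuous_in_subspaceT => t; rewrite inE/= in_itv/= => tab.
  apply: (@cvg_ebin R (nbhs t) _ phi (derive1 phi)).
  - by rewrite -gphi//; exact: posdef_unit (svalP (g t)).
  - apply: differentiable_continuous; apply/derivable1_diffP.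
    by case: cphi.
  - by case: cphi => _; exact.
exists (Num.max (Num.max (speed crd met g a) (w c)) C) => t /andP[at_ tl].
rewrite !le_max; have [bt|tb] := leP b t; first by rewrite HC ?bt// orbT.
move: at_; rewrite le_eqVlt => /predU1P[<-|at_]; first by rewrite lexx.
have tab : t \in `[a, b] by rewrite in_itv/= !ltW.
apply/orP; left; apply/orP; right; apply: le_trans (Hc t tab).
rewrite /speed /met /spd_metric /w.
have -> : derive1 (crd \o g) t = derive1 phi t.
  rewrite !derive1E; apply: near_eq_derive; near=> u; apply: gphi.
  apply/andP; split; apply: ltW; near: u.
    exact: (cvgr_gt _ (@cvg_id _ (nbhs t))).
  exact: lt_nbhsl.
by rewrite -gphi// !ltW.
Unshelve. all: by end_near. Qed.

(** Curves are defined on the whole line, whereas a segment is only known to stay positive-definite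
    for parameters in [[0, 1]]; clamping freezes it outside. *)
Definition clamp (t : R) := Num.max 0 (Num.min t 1).

Lemma clamp01 t : 0 <= clamp t <= 1.
Proof. by rewrite /clamp le_max lexx/= ge_max ler01 ge_min lexx orbT. Qed.

Lemma clamp_id t : 0 <= t <= 1 -> clamp t = t.
Proof. by move=> /andP[t0 t1]; rewrite /clamp min_l// max_r. Qed.

Definition spd_segment (H K : spdR) (t : R) : spdR :=
  exist _ _ (posdef_convex (clamp01 t) (svalP H) (svalP K)).

Lemma spd_segment_C1 (H K : spdR) : piecewise_C1 crd (spd_segment H K).
Proof.
apply/piecewise_C1P; exists [::]; rewrite /= andbT; apply/asboolP; split=> //.
exists (fun t => sval H + t *: (sval K - sval H)); first exact: C1_segment.
by move=> t t01; rewrite /= /crd/= clamp_id.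
Qed.

Lemma spd_segment0 (H K : spdR) : spd_segment H K 0 = H.
Proof.
by apply: spd_eq; rewrite /= clamp_id ?lexx ?ler01// scale0r addr0.
Qed.

Lemma spd_segment1 (H K : spdR) : spd_segment H K 1 = K.
Proof.
by apply: spd_eq; rewrite /= clamp_id ?lexx ?ler01// scale1r addrC subrK.
Qed.

Lemma spd_pseudo_metric : pseudo_metric (@spd_dist R n).
Proof.
apply: riemannian_pseudo_metric.
- exact: spd_metricZ.
- exact: spd_speed_bounded.
- move=> H K; exists (spd_segment H K).
  by split; [exact: spd_segment_C1|exact: spd_segment0|exact: spd_segment1].
Qed.

(* The metric is continuous, so short segments are short curves. *)
Lemma spd_dist_near (H : spdR) e : 0 < e ->
  \forall B \near sval H, forall K : spdR, sval K = B -> spd_dist H K < e.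
Proof.
move=> e0; have e2 : 0 < e / 2 by rewrite divr_gt0.
pose w (z : 'M[R]_n * 'M[R]_n) := Num.sqrt (\tr (invmx z.1 *m z.2 *m invmx z.1 *m z.2)
  * Num.sqrt (\det z.1)).
have wc : w z @[z --> (sval H, 0 : 'M[R]_n)] --> (0 : R).
  rewrite [X in _ --> X](_ : 0 = w (sval H, 0)); last first.
    by rewrite /w /= mulmx0 mxtrace0 mul0r sqrtr0.
  apply: cvg_ebin; [exact: posdef_unit (svalP H)|exact: cvg_fst|exact: cvg_snd].
have /nbhs_ballP[d d0 Hd] : \forall z \near (sval H, 0 : 'M[R]_n), w z < e / 2.
  exact: (cvgr_lt _ wc).
apply/nbhs_ballP; exists d => // B; rewrite -ball_normE /ball_/= => HB K KB.
suff H1 t : 0 < t < 1 -> speed crd met (spd_segment H K) t <= e / 2.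
  apply: (@le_lt_trans _ _ (e / 2)); last by rewrite ltr_pdivrMr// ltr_pMr// ltr1n.
  apply: le_trans (curve_length_le spd_speed_bounded (spd_segment_C1 H K) H1).
  apply: riemannian_dist_le; [exact: spd_segment_C1|exact: spd_segment0|exact: spd_segment1].
move=> /andP[t0 t1].
have D : derive1 (crd \o spd_segment H K) t = sval K - sval H.
  rewrite -[RHS](derive1_segment (sval H) (sval K - sval H) t) !derive1E.
  apply: near_eq_derive; near=> s; rewrite /= clamp_id//.
  apply/andP; split; apply: ltW; near: s.
    exact: (cvgr_gt _ (@cvg_id _ (nbhs t))).
  exact: lt_nbhsl.
have BH : `|sval K - sval H| < d.
  by rewrite KB distrC.
suff BB : ball (sval H, 0 : 'M[R]_n) d (sval (spd_segment H K t), sval K - sval H).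
  by rewrite /speed D; apply/ltW; exact: (Hd _ BB).
split; last by rewrite -ball_normE /ball_/= add0r normrN.
  change (ball (sval H) d (sval H + clamp t *: (sval K - sval H))).
  rewrite -ball_normE /ball_/= opprD addrA subrr add0r normrN normrZ.
  apply: le_lt_trans BH; rewrite ler_piMl// ger0_norm.
    by case/andP: (clamp01 t).
  by case/andP: (clamp01 t).
Unshelve. all: by end_near. Qed.

End PosDef.

(** * Changes of charts and tensors *)

Lemma near_eq_continuous (T U : topologicalType) (f g : T -> U) p :
  (\forall q \near p, f q = g q) -> {for p, continuous f} -> {for p, continuous g}.
Proof.
move=> fg; rewrite /prop_for /continuous_at -(nbhs_singleton fg).
by move=> cf; apply: cvg_trans cf; exact: near_eq_cvg.
Qed.

Lemma continuous_entry (R : realType) m n (T U : topologicalType) (f : T -> U)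
    (g : U -> 'M[R]_(m, n)) p i j : {for p, continuous f} ->
  {for f p, continuous g} -> {for p, continuous (fun q => g (f q) i j)}.
Proof.
move=> cf cg; have cgf : {for p, continuous (g \o f)} by exact: continuous_comp.
exact: (continuous_comp cgf (@coord_continuous R m n i j (g (f p)))).
Qed.

Section NearEqDiff.
Variables (R : realType) (V W : normedModType R).

Lemma near_eq_diff (f g : V -> W) x : (\forall y \near x, f y = g y) ->
  differentiable f x -> differentiable g x /\ 'd g x = 'd f x :> (V -> W).
Proof.
move=> fg df; have cdf : continuous ('d f x) by exact: diff_continuous.
have H : g \o shift x = cst (g x) + 'd f x +o_ 0 id.
  have := diff_locally df => /eqaddoP fo; apply/eqaddoP => e e0.
  have {}fg : \forall h \near 0, f (h + x) = g (h + x).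
    by move: fg; rewrite (near_shift 0) subr0; apply: filterS => h; rewrite /= .
  have fgx : f x = g x by have := nbhs_singleton fg; rewrite add0r.
  near=> h.
  have -> : (g \o shift x - (cst (g x) + 'd f x)) h = (f \o shift x - (cst (f x) + 'd f x)) h.
    rewrite /GRing.add/GRing.opp /= /GRing.add/= -fgx; congr (_ + _).
    by apply/esym; near: h.
  by near: h; exact: fo.
have dg : 'd g x = 'd f x :> (V -> W) by exact: diff_unique H.
split; last exact: dg.
by apply/diff_locallyP; rewrite dg; split; [exact: cdf|exact: H].
Unshelve. all: by end_near. Qed.

End NearEqDiff.

Lemma mul_jacobian (R : realType) m n (f : 'rV[R]_m -> 'rV[R]_n) x u :
  u *m jacobian f x = 'd f x u.
Proof. by rewrite /jacobian mul_rV_lin1. Qed.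

(** Jacobians act on row vectors, so the factor of [f] comes first. Equality near [x] is the right
    hypothesis for transition maps, which are meaningful on overlaps only. *)
Lemma jacobian_near_comp (R : realType) m n p (f : 'rV[R]_m -> 'rV[R]_n)
    (g : 'rV[R]_n -> 'rV[R]_p) (h : 'rV[R]_m -> 'rV[R]_p) x y :
  f x = y -> (\forall z \near x, (g \o f) z = h z) ->
  differentiable f x -> differentiable g y ->
  differentiable h x /\ jacobian h x = jacobian f x *m jacobian g y.
Proof.
move=> <- gfh df dg.
have dgf : differentiable (g \o f) x by exact: differentiable_comp.
have [dh e] := near_eq_diff gfh dgf; split; first exact: dh.
apply/row_matrixP => i; rewrite !rowE mulmxA !mul_jacobian e.
by rewrite (diff_comp df dg).
Qed.

Lemma jacobian_near_id (R : realType) n (f : 'rV[R]_n -> 'rV[R]_n) x :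
  (\forall z \near x, z = f z) -> jacobian f x = 1%:M.
Proof.
move=> fid; have di := is_diff_id x.
have [_ e] := near_eq_diff fid (@ex_diff _ _ _ _ _ _ _ di).
apply/row_matrixP => i; rewrite !rowE mulmx1 mul_jacobian e.
by case: di => _ ->.
Qed.

Section ChartTheory.
Variables (R : realType) (n : nat) (M : ptopologicalType).
Variable A : smooth_atlas R n M.
Implicit Types (c : chart R n M) (p : M).
Local Notation charts_at := (charts_at A).

Lemma smooth_transition_diff c c' p : smooth_transition c c' ->
  cdom c p -> cdom c' p -> differentiable (transition c c') (cmap c p).
Proof. by move=> /(_ 1%N)[+ _] cp c'p; apply; exists p. Qed.

Lemma transition_comp c c'' c' p : cdom c p -> cdom c'' p ->
  \forall x \near cmap c p, (transition c'' c' \o transition c c'') x = transition c c' x.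
Proof.
move=> cp c''p; have : \forall x \near cmap c p, cdom c'' (cinv c x).
  apply: (cinv_continuous cp); rewrite cmapK//.
  exact: open_nbhs_nbhs (conj (cdom_open c'') c''p).
by apply: filterS => x c''x; rewrite /transition/= cmapK.
Qed.

Lemma transition_cmap c c' p : cdom c p -> transition c c' (cmap c p) = cmap c' p.
Proof. by move=> cp; rewrite /transition/= cmapK. Qed.

Lemma transition_chain c c'' c' p : cdom c p -> cdom c'' p ->
  differentiable (transition c c'') (cmap c p) ->
  differentiable (transition c'' c') (cmap c'' p) ->
  differentiable (transition c c') (cmap c p) /\
  jac c c' p = jac c c'' p *m jac c'' c' p.
Proof.
move=> cp c''p; apply: jacobian_near_comp; first exact: transition_cmap.
exact: transition_comp.
Qed.

(** [smooth_chart] relates a chart to the charts of the given atlas only; two charts of the maximal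
    atlas are compared through an atlas chart at [p]. *)
Lemma transition_differentiable p c c' : charts_at p c -> charts_at p c' ->
  differentiable (transition c c') (cmap c p).
Proof.
move=> [sc cp] [sc' c'p]; have [c'' Ac'' c''p] := atlas_cover A p.
apply: (proj1 (@transition_chain c c'' c' p cp c''p _ _)).
  by apply: smooth_transition_diff => //; have [] := sc _ Ac''.
by apply: smooth_transition_diff => //; have [] := sc' _ Ac''.
Qed.

Lemma jac_chain p c c'' c' : charts_at p c -> charts_at p c'' -> charts_at p c' ->
  jac c c' p = jac c c'' p *m jac c'' c' p.
Proof.
move=> cp c''p c'p; apply: (proj2 (@transition_chain c c'' c' p cp.2 c''p.2 _ _));
  exact: transition_differentiable.
Qed.

Lemma jac_refl p c : cdom c p -> jac c c p = 1%:M.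
Proof.
move=> cp; have H : \forall x \near cmap c p, x = transition c c x.
  have : \forall x \near cmap c p, (cmap c @` cdom c) x.
    by apply: open_nbhs_nbhs; split; [exact: cimg_open|exists p].
  by apply: filterS => _ [q cq <-]; rewrite transition_cmap.
exact: jacobian_near_id H.
Qed.

Lemma jac_inv p c c' : charts_at p c -> charts_at p c' ->
  jac c c' p *m jac c' c p = 1%:M.
Proof. by move=> cp c'p; rewrite -jac_chain// jac_refl//; case: cp. Qed.

Lemma jac_unit p c c' : charts_at p c -> charts_at p c' -> jac c c' p \in unitmx.
Proof. by move=> cp c'p; exact: (proj1 (mulmx1_unit (jac_inv cp c'p))). Qed.

(** The rows of the Jacobian are the partial derivatives, whose continuity is the order 1 part of
    smoothness. *)
Lemma smooth_jac_continuous p c c' : smooth_transition c c' ->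
  cdom c p -> cdom c' p -> {for p, continuous (jac c c')}.
Proof.
move=> st cp c'p; have [sd sD] := st 1%N.
suff ent i j : {for p, continuous (fun q => jac c c' q i j)}.
  by apply/cvg_mxP => i j; exact: ent.
have H : \forall q \near p, ('D_(delta_mx 0 i) (transition c c') (cmap c q)) 0 j =
    jac c c' q i j.
  have : \forall q \near p, (cdom c `&` cdom c') q.
    apply: open_nbhs_nbhs; split; last by split.
    by apply: openI; exact: cdom_open.
  apply: filterS => q [cq c'q]; rewrite deriveEjacobian; last first.
    exact: smooth_transition_diff.
  by rewrite -rowE mxE.
apply: (near_eq_continuous H).
apply: (@continuous_entry _ _ _ _ _ (cmap c) ('D_(delta_mx 0 i) (transition c c'))).
  exact: cmap_continuous.
by apply: sD; exists p.
Qed.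

Lemma jac_continuous p c c' : charts_at p c -> charts_at p c' ->
  {for p, continuous (jac c c')}.
Proof.
move=> [sc cp] [sc' c'p]; have [c'' Ac'' c''p] := atlas_cover A p.
have sc'' : smooth_chart A c''.
  by move=> c3 Ac3; split; [exact: atlas_smooth Ac'' Ac3|exact: atlas_smooth Ac3 Ac''].
have H : \forall q \near p, jac c c'' q *m jac c'' c' q = jac c c' q.
  have : \forall q \near p, (cdom c `&` cdom c' `&` cdom c'') q.
    apply: open_nbhs_nbhs; split; last by split.
    by apply: openI; [apply: openI|]; exact: cdom_open.
  by apply: filterS => q [[cq c'q] c''q]; rewrite -jac_chain.
apply: (near_eq_continuous H).
apply: (@cvg_mulmx _ _ (nbhs p) _ _ _ _ (jac c c'') (jac c'' c')).
  by apply: smooth_jac_continuous => //; have [] := sc _ Ac''.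
by apply: smooth_jac_continuous => //; have [] := sc' _ Ac''.
Qed.

End ChartTheory.

(** * Riemannian distances under linear changes of coordinates *)

Section DistTransport.
Variables (R : realType) (n : nat) (X Y : Type).
Variables (crdX : X -> 'M[R]_n) (crdY : Y -> 'M[R]_n).
Variable metX : X -> 'M[R]_n -> 'M[R]_n -> R.
Variable metY : Y -> 'M[R]_n -> 'M[R]_n -> R.
Variables (f : X -> Y) (J K : 'M[R]_n).
Hypotheses (bf : bijective f) (KJ : K *m J = 1%:M).
Hypothesis crdE : forall x, crdX x = J *m crdY (f x) *m J^T.
Hypothesis metE : forall x a, metX x (J *m a *m J^T) (J *m a *m J^T) = metY (f x) a a.

Let crdE' x : crdY (f x) = K *m crdX x *m K^T.
Proof.
by rewrite crdE !mulmxA KJ mul1mx -mulmxA -trmx_mul KJ trmx1 mulmx1.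
Qed.

Let pw_congr (Z : Type) (L : 'M[R]_n) (cx : Z -> 'M[R]_n) (W : Type) (cy : W -> 'M[R]_n)
    (g : R -> Z) (h : R -> W) :
  (forall t, cy (h t) = L *m cx (g t) *m L^T) ->
  piecewise_C1 cx g -> piecewise_C1 cy h.
Proof.
move=> gh [s ps Hs]; exists s => // i si; have [phi cphi gphi] := Hs i si.
exists (fun t => L *m phi t *m L^T); first exact: C1_congr.
by move=> t ti; rewrite gh gphi.
Qed.

Let length_congr (g : R -> X) :
  curve_length crdX metX g = curve_length crdY metY (f \o g).
Proof.
apply: eq_Rintegral => t _; congr Num.sqrt; rewrite /= -metE.
suff -> : derive1 (crdX \o g) t = J *m derive1 (crdY \o (f \o g)) t *m J^T by [].
rewrite -(derive1_congr _ _ KJ); congr (derive1 _ t).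
by apply/funext => u /=; exact: crdE.
Qed.

(** Composition with [f] matches the curves of the two sides, and congruence by the constant matrix
    [J] commutes with differentiation, so both infima run over the same set of lengths. *)
Lemma riemannian_dist_transport x y :
  riemannian_dist crdX metX x y = riemannian_dist crdY metY (f x) (f y).
Proof.
have [f' fK f'K] := bf; congr inf; apply/seteqP; split => _ [g [pg g0 g1] <-].
  exists (f \o g); last by rewrite length_congr.
  split; [|by rewrite /= g0|by rewrite /= g1].
  by apply: pw_congr pg => t; exact: crdE'.
exists (f' \o g); last by rewrite length_congr; congr curve_length; apply/funext => t /=.
split; [|by rewrite /= g0|by rewrite /= g1].
by apply: pw_congr pg => t; rewrite crdE /= f'K.
Qed.

End DistTransport.

(** * Tensors at a point and their matrices *)

Section Tensors.
Variables (R : realType) (n : nat) (M : ptopologicalType).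
Variable A : smooth_atlas R n M.
Implicit Types (c : chart R n M) (p : M).
Local Notation charts_at := (charts_at A).
Local Notation spdR := (spd R n).

Lemma pos_tensor_eq p (h k : pos_tensor A p) : (forall c, h c = k c) -> h = k.
Proof.
case: h k => [[h ho hs hc] hp] [[k ko ks kc] kp] /= hk.
have hk' : h = k by apply/funext.
subst k; rewrite (Prop_irrelevance ho ko) (Prop_irrelevance hs ks).
rewrite (Prop_irrelevance hc kc) in hp kp *.
by rewrite (Prop_irrelevance hp kp).
Qed.

Section TensorOfMatrix.
Variables (p : M) (c : chart R n M) (cp : charts_at p c) (H : spdR).

Let tm (c' : chart R n M) : 'M[R]_n :=
  if pselect (charts_at p c') then jac c' c p *m sval H *m (jac c' c p)^T else 0.

Let tm_in c' : charts_at p c' -> tm c' = jac c' c p *m sval H *m (jac c' c p)^T.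
Proof. by rewrite /tm; case: pselect. Qed.

Let tm_out c' : ~ charts_at p c' -> tm c' = 0.
Proof. by rewrite /tm; case: pselect. Qed.

Let tm_sym c' : charts_at p c' -> (tm c')^T = tm c'.
Proof.
by move=> c'p; rewrite tm_in// !trmx_mul trmxK (proj1 (svalP H)) mulmxA.
Qed.

(** The transformation law is the cocycle identity of the Jacobians. *)
Let tm_change c' c'' : charts_at p c' -> charts_at p c'' ->
  tm c' = jac c' c'' p *m tm c'' *m (jac c' c'' p)^T.
Proof.
move=> c'p c''p; rewrite (tm_in c'p) (tm_in c''p).
move: (jac_chain c'p c''p cp).
by move: (jac c' c p) (jac c' c'' p) (jac c'' c p) => _ B C ->; rewrite trmx_mul !mulmxA.
Qed.

Let tm_pos c' : charts_at p c' -> posdef (tm c').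
Proof.
move=> c'p; rewrite tm_in//; apply: posdef_congr (svalP H).
exact: jac_unit c'p cp.
Qed.

Definition tensor_of_matrix : pos_tensor A p :=
  @PosTensor R n M A p (SymTensor tm_out tm_sym tm_change) tm_pos.

Lemma tensor_of_matrixE : tensor_of_matrix c = sval H.
Proof. by rewrite /= tm_in// jac_refl ?mul1mx ?trmx1 ?mulmx1//; case: cp. Qed.

End TensorOfMatrix.

Lemma coord_matrix_bij p c (cp : charts_at p c) : bijective (coord_matrix cp).
Proof.
exists (tensor_of_matrix cp) => [h|H]; last first.
  by apply: spd_eq; rewrite /= -[RHS](tensor_of_matrixE cp H).
apply: pos_tensor_eq => c'; have [c'p|nc'p] := pselect (charts_at p c').
  by rewrite (tmat_change _ c'p cp) [RHS](tmat_change _ c'p cp) tensor_of_matrixE.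
by rewrite !tmat_out.
Qed.

Variable g0 : riemannian_metric A.

(** In the trace the factors [J] cancel by cyclicity; in the determinant they cancel because [G] and
    [H] both acquire the square of [\det J], and [\det G = 1] removes what is left of [G]. *)
Lemma ebin_metric_congr (J G H a b : 'M[R]_n) : J \in unitmx -> G \in unitmx ->
  H \in unitmx -> \det G = 1 ->
  ebin_metric (J *m G *m J^T) (J *m H *m J^T) (J *m a *m J^T) (J *m b *m J^T) =
  \tr (invmx H *m a *m invmx H *m b) * Num.sqrt (\det H).
Proof.
move=> uJ uG uH dG; have uJT : J^T \in unitmx by rewrite unitmx_tr.
have inv3 B : B \in unitmx -> invmx (J *m B *m J^T) = invmx J^T *m invmx B *m invmx J.
  move=> uB; have uJBJ : J *m B *m J^T \in unitmx by rewrite !unitmx_mul uJ uB uJT.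
  apply: (can_inj (mulKmx uJBJ)); rewrite mulmxV// !mulmxA.
  by rewrite mulmxK// mulmxK// mulmxV.
rewrite /ebin_metric !inv3//; congr (_ * _).
  rewrite !mulmxA mulmxKV// mulmxKV//.
  rewrite mxtrace_mulC !mulmxA.
  by rewrite mulmxV// mul1mx mulmxK.
congr Num.sqrt; rewrite !det_mulmx !det_inv dG invr1 !det_tr mulr1.
have dJ : \det J != 0 by rewrite -unitfE -unitmxE.
by rewrite -!mulrA mulKf// mulrCA mulVf ?mulr1.
Qed.

(** [fiber_metric] is read in the chosen chart [chart_at A p], not in [c]; the isometry is transport
    along the change of coordinates between the two. *)
Lemma coord_matrix_isometry p c (cp : charts_at p c) (h k : pos_tensor A p) :
  \det (g0 p c) = 1 ->
  spd_dist (coord_matrix cp h) (coord_matrix cp k) = fiber_dist g0 h k.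
Proof.
move=> dg; have c0p := chart_atP A p.
apply/esym; apply: (@riemannian_dist_transport _ _ _ _ _ _ _ _ (coord_matrix cp)
  (jac (chart_at A p) c p) (jac c (chart_at A p) p)).
- exact: coord_matrix_bij.
- exact: jac_inv cp c0p.
- by move=> {}h; exact: tmat_change c0p cp.
- move=> {}h a; rewrite /fiber_metric (tmat_change (g0 p) c0p cp) (tmat_change h c0p cp).
  rewrite ebin_metric_congr//.
  + exact: jac_unit c0p cp.
  + exact: posdef_unit (ptensor_pos (g0 p) cp).
  + exact: posdef_unit (ptensor_pos h cp).
Qed.

End Tensors.

(** * Volume charts *)

Section Boxes.
Variable R : realType.
Local Notation mR := (measurableTypeR R).

(** These are the balls of the sup norm on row vectors. The centre is a sequence, so that induction
    on the dimension can shift it. *)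
Definition tuple_box n (x : nat -> R) (r : R) : set (n.-tuple mR) :=
  [set t | forall i : 'I_n, x i - r < tnth t i < x i + r].

Lemma measurable_tuple_box n x r : measurable (@tuple_box n x r).
Proof.
have -> : @tuple_box n x r = \bigcap_(i in [set: 'I_n])
    ((fun t : n.-tuple mR => tnth t i) @^-1` `]x i - r, x i + r[).
  apply/seteqP; split => [t xt i _|t xt i]; first by rewrite /= in_itv/=; exact: xt.
  by have := xt i I; rewrite /= in_itv.
apply: fin_bigcap_measurable => [|i _]; first exact: finite_finset.
by rewrite -[X in measurable X]setTI; apply: measurable_tnth.
Qed.

Lemma lebesgue_n_box n x r : 0 < r ->
  lebesgue_n R n (@tuple_box n x r) = ((r *+ 2) ^+ n)%:E.
Proof.
move=> r0; elim: n x => [|n IH] x.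
  rewrite expr0 /lebesgue_n /= /measure_power /= /dirac indicE mem_set// => -[].
  by [].
have -> : lebesgue_n R n.+1 (@tuple_box n.+1 x r) =
   (@lebesgue_measure R \x lebesgue_n R n)%E (@tcons _ mR n @^-1` @tuple_box n.+1 x r).
  by [].
have -> : @tcons _ mR n @^-1` @tuple_box n.+1 x r =
    `]x 0%N - r, x 0%N + r[%classic `*` @tuple_box n (fun i => x i.+1) r.
  apply/seteqP; split => [[u t] /= xt|[u t] /= [xu xt] i].
    split=> [|i]; first by have := xt ord0; rewrite in_itv.
    by have := xt (lift ord0 i); rewrite tnthS.
  have [->|[j ->]] : i = ord0 \/ exists j, i = lift ord0 j.
  - by case: (unliftP ord0 i) => [j ->|->]; [right; exists j|left].
  - by move: xu; rewrite in_itv.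
  - by rewrite tnthS; exact: xt.
rewrite product_measure1E//; last exact: measurable_tuple_box.
rewrite IH exprS EFinM; congr (_ * _)%E.
rewrite -[LHS]/(lebesgue_measure `]x 0%N - r, x 0%N + r[%classic).
rewrite lebesgue_measure_itv/= lte_fin ltrD2l gtrN// -EFinB; congr EFin.
by rewrite opprB [x 0%N + r]addrC addrACA subrr addr0.
Qed.

End Boxes.

Section VolumeCharts.
Variables (R : realType) (n : nat) (M : ptopologicalType).
Variables (A : smooth_atlas R n M) (g0 : riemannian_metric A).
Variable mu : {measure set (borel M) -> \bar R}.

Lemma open_borel (U : set M) : open U -> measurable (U : set (borel M)).
Proof. by move=> oU; exact: sub_sigma_algebra. Qed.

Lemma riemannian_metric_continuous c p : smooth_chart A c -> cdom c p ->
  {for cmap c p, continuous (fun x => g0 (cinv c x) c : 'M[R]_n)}.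
Proof. by move=> sc cp; apply: (rmetric_smooth g0 sc 0%N); exists p. Qed.

Let box_chart c p (P : set 'rV[R]_n) : cdom c p -> nbhs (cmap c p) P ->
  exists (B : set M) x r, [/\ 0 < r, open B, B `<=` cdom c,
    @row_of_tuple R n @^-1` (cmap c @` B) = @tuple_box R n x r &
    cmap c @` B `<=` P].
Proof.
move=> cp nP; have : nbhs (cmap c p) (P `&` cmap c @` cdom c).
  by apply: filterI => //; apply: open_nbhs_nbhs; split; [exact: cimg_open|exists p].
move=> /nbhs_ballP[r r0 rP]; pose Q := ball (cmap c p) r.
have oQ : open Q.
  exact: ball_open.
(* The centre is the row [cmap c p], extended by 0 to a sequence. *)
exists (cdom c `&` cmap c @^-1` Q), (fun i => if insub i is Some j then cmap c p 0 j else 0), r.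
have BQ : cmap c @` (cdom c `&` cmap c @^-1` Q) = Q.
  apply/seteqP; split => [_ [q [cq Qq] <-]//|y Qy].
  by have [_ [q cq qy]] := rP _ Qy; exists q => //; split=> //; rewrite /= qy.
split=> //.
- rewrite openE => q [cq Qq]; apply: filterI.
    exact: open_nbhs_nbhs (conj (cdom_open c) cq).
  apply: (cmap_continuous cq); exact: open_nbhs_nbhs (conj oQ Qq).
- rewrite BQ; apply/seteqP; split => [t [_ xt] i|t xt].
    have := xt 0 i; rewrite [row_of_tuple t _ _]mxE -ball_normE /ball_/= distrC ltr_distl.
    rewrite (_ : insub (i : nat) = Some i)//.
    by rewrite insubT//= => ?; congr Some; apply: val_inj.
  split=> // i j; rewrite [row_of_tuple t i j]mxE -ball_normE /ball_/= distrC ltr_distl ord1.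
  have := xt j; rewrite (_ : insub (j : nat) = Some j)//.
  by rewrite insubT//= => ?; congr Some; apply: val_inj.
- by rewrite BQ => y /rP[].
Qed.

(** The measure of the preimage of a small box is computed both by [vol] and by volume preservation,
    so [G], the square root of [\det g0], has mean 1 on boxes contained in any neighbourhood of
    [cmap c p]. By continuity, a value other than 1 there would keep [G] strictly on one side of 1
    on such a box. *)
Lemma volume_chart_det c p : volume_measure g0 mu -> smooth_chart A c ->
  volume_preserving mu c -> cdom c p -> \det (g0 p c) = 1.
Proof.
move=> vol sc vc cp; pose G x : R := Num.sqrt (\det (g0 (cinv c x) c : 'M[R]_n)).
have cG : {for cmap c p, continuous G}.
  apply: (@continuous_comp _ _ _ (fun x => \det (g0 (cinv c x) c : 'M[R]_n)) Num.sqrt).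
    apply: (@cvg_det _ _ (nbhs (cmap c p)) _ _ (fun x => g0 (cinv c x) c : 'M[R]_n)).
    exact: riemannian_metric_continuous.
  exact: sqrt_continuous.
have boxI (P : set 'rV[R]_n) : nbhs (cmap c p) P -> exists x r, [/\ 0 < r,
    @tuple_box R n x r `<=` @row_of_tuple R n @^-1` P &
    (\int[lebesgue_n R n]_(t in @tuple_box R n x r) (G (row_of_tuple t))%:E =
      ((r *+ 2) ^+ n)%:E)%E].
  move=> nP; have [B [x [r [r0 oB Bc Bx BP]]]] := box_chart cp nP.
  exists x, r; split=> //; first by rewrite -Bx => t; exact: BP.
  have mB := open_borel oB.
  by rewrite -(lebesgue_n_box n x r0) -Bx -(vol c sc B mB Bc) (vc B mB Bc).
suff G1 : G (cmap c p) = 1.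
  move: G1; rewrite /G cmapK// => G1.
  have d0 : 0 <= \det (g0 p c).
    by rewrite leNgt; apply/negP => /ltW/ler0_sqrtr H; move: G1; rewrite H => /eqP; rewrite eq_sym oner_eq0.
  by rewrite -(sqr_sqrtr d0) G1 expr1n.
have int_cst x r m : 0 < r -> (\int[lebesgue_n R n]_(t in @tuple_box R n x r) m%:E =
    (m * (r *+ 2) ^+ n)%:E)%E.
  move=> r0; have mb := @measurable_tuple_box R n x r.
  rewrite integral_cst//; transitivity (m%:E * lebesgue_n R n (@tuple_box R n x r))%E; first by [].
  by rewrite lebesgue_n_box// EFinM.
have pr r : 0 < r -> 0 < (r *+ 2) ^+ n by move=> r0; rewrite exprn_gt0// pmulrn_lgt0.
apply/eqP; rewrite eq_le; apply/andP; split; rewrite leNgt; apply/negP => Gp.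
  (* The midpoint lies strictly between 1 and the value of [G], so [G] can be compared on the box
     with a constant, whose integral is known. *)
  pose m := (G (cmap c p) + 1) / 2.
  have mG : m < G (cmap c p) by rewrite ltr_pdivrMr// mulr_natr mulr2n ltrD2l.
  have m1 : 1 < m by rewrite ltr_pdivlMr// mul1r ltrD2r.
  have [x [r [r0 rm rI]]] := boxI _ (cvgr_gt _ cG _ mG).
  have : (\int[lebesgue_n R n]_(t in @tuple_box R n x r) m%:E <=
      \int[lebesgue_n R n]_(t in @tuple_box R n x r) (G (row_of_tuple t))%:E)%E.
    apply: ge0_le_integral_nm => t tx; rewrite lee_fin.
      by rewrite ltW// (lt_trans _ m1).
    by rewrite ltW//; exact: rm.
  by rewrite rI int_cst// lee_fin ger_pMl ?pr// leNgt m1.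
pose m := (G (cmap c p) + 1) / 2.
have Gm : G (cmap c p) < m by rewrite ltr_pdivlMr// mulr_natr mulr2n ltrD2l.
have m1 : m < 1 by rewrite ltr_pdivrMr// mul1r ltrD2r.
have [x [r [r0 rm rI]]] := boxI _ (cvgr_lt _ cG _ Gm).
have : (\int[lebesgue_n R n]_(t in @tuple_box R n x r) (G (row_of_tuple t))%:E <=
    \int[lebesgue_n R n]_(t in @tuple_box R n x r) m%:E)%E.
  apply: ge0_le_integral_nm => t tx; rewrite lee_fin; first exact: sqrtr_ge0.
  by rewrite ltW//; exact: rm.
by rewrite rI int_cst// lee_fin ler_pMl ?pr// leNgt m1.
Qed.

End VolumeCharts.

(** * Sections and maps *)

Section AeClasses.
Variables (R : realType) (M : ptopologicalType).
Variable mu : {measure set (borel M) -> \bar R}.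

(** Classes are mapped through chosen representatives. These differ from the intended functions on a
    null set, which changes no lower integral. *)
Lemma ae_classes_isometric (F G : M -> Type) (dF : forall p, F p -> F p -> R)
    (dG : forall p, G p -> G p -> R) (QF : set (forall p, F p))
    (QG : set (forall p, G p)) (phi : forall p, F p -> G p)
    (psi : forall p, G p -> F p) :
  (forall p, cancel (@phi p) (@psi p)) -> (forall p, cancel (@psi p) (@phi p)) ->
  (forall p x y, dG p (phi p x) (phi p y) = dF p x y) ->
  (forall s, QF s -> QG (fun p => phi p (s p))) ->
  (forall t, QG t -> QF (fun p => psi p (t p))) ->
  isometric (L2_dist (mu := mu) dF (Q := QF)) (L2_dist (mu := mu) dG (Q := QG)).
Proof.
move=> phiK psiK iso QFG QGF.
pose aeq (H : M -> Type) (Q : set (forall p, H p)) (s t : {s : forall p, H p | Q s}) :=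
  {ae mu, forall p, sval s p = sval t p}.
have FF : Filter (almost_everywhere mu) by exact: _.
have refl H Q s : @aeq H Q s s by apply: aeW.
have sym H Q s t : @aeq H Q s t -> @aeq H Q t s.
  by apply: (@filterS _ _ FF) => p ->.
have trans H Q s t u : @aeq H Q s t -> @aeq H Q t u -> @aeq H Q s u.
  by apply: (@filterS2 _ _ FF) => p -> ->.
pose phiS (s : {s | QF s}) : {t | QG t} := exist _ _ (QFG _ (svalP s)).
pose psiS (t : {t | QG t}) : {s | QF s} := exist _ _ (QGF _ (svalP t)).
pose f (S : ae_classes mu QF) : ae_classes mu QG := cls (@aeq G QG) (phiS (rep S)).
pose g (T : ae_classes mu QG) : ae_classes mu QF := cls (@aeq F QF) (psiS (rep T)).
have repE H Q (s : {s : forall p, H p | Q s}) : aeq H Q s (rep (cls (@aeq H Q) s)).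
  exact: rep_cls.
exists f.
  exists g => [S|T].
    transitivity (cls (@aeq F QF) (rep S)); last first.
    exact: (@repK _ (@aeq F QF) (@refl F QF) (@sym F QF) (@trans F QF)).
   apply: (cls_eq (@sym F QF) (@trans F QF)).
    apply: sym; apply: (@filterS _ _ FF) (repE _ _ (phiS (rep S))) => p /= <-.
    by rewrite phiK.
  transitivity (cls (@aeq G QG) (rep T)); last first.
    exact: (@repK _ (@aeq G QG) (@refl G QG) (@sym G QG) (@trans G QG)).
   apply: (cls_eq (@sym G QG) (@trans G QG)).
  apply: sym; apply: (@filterS _ _ FF) (repE _ _ (psiS (rep T))) => p /= <-.
  by rewrite psiK.
move=> S T; rewrite /L2_dist; congr Num.sqrt; congr fine.
apply: ae_eq_integral_nm => [p|p|]; try by rewrite lee_fin sqr_ge0.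
apply: (@filterS2 _ _ FF) (repE _ _ (phiS (rep S))) (repE _ _ (phiS (rep T))) => p /= <- <-.
by rewrite iso.
Qed.

End AeClasses.

Section SecondCountable.
Variables (M : ptopologicalType) (Y : topologicalType).

Lemma borel_map_open (Z : Type) (op : set (set Z)) (f : M -> Z) :
  (forall U, op U -> measurable (f @^-1` U : set (borel M))) -> borel_map op f.
Proof.
move=> fU B; apply: (smallest_sub (X := [set B | measurable (f @^-1` B : set (borel M))])) => //.
split.
- by rewrite /= preimage_set0; exact: measurable0.
- by move=> C mC; rewrite /= setTD -preimage_setC; exact: measurableC.
- by move=> C mC; rewrite /= preimage_bigcup; apply: bigcup_measurable => k _; exact: mC.
Qed.

Lemma countable_bigcup_measurable d (T : measurableType d) (I : choiceType) (D : set I)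
    (F : I -> set T) : countable D -> (forall i, D i -> measurable (F i)) ->
  measurable (\bigcup_(i in D) F i).
Proof.
move=> cD mF; have [->|/set0P[r Dr]] := eqVneq D set0.
  by rewrite bigcup_set0; exact: measurable0.
have [f injf] := countable_injP _ cD.
rewrite (_ : \bigcup_(i in D) F i = \bigcup_(k in f @` D) F ('pinv_(cst r) D f k)).
  by apply: bigcup_measurable => _ [i Di <-]; rewrite pinvKV ?inE//; exact: mF.
apply/seteqP; split => [x [i Di Fx]|x [_ [i Di <-]]].
  by exists (f i); [exists i|rewrite pinvKV ?inE].
by rewrite pinvKV ?inE// => Fx; exists i.
Qed.

(* An open subset of the product is a countable union of open rectangles. *)
Lemma measurable_graph_open (f : M -> Y) (O : set (M * Y)) :
  @second_countable M -> borel_map open f -> open O ->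
  measurable ([set p | O (p, f p)] : set (borel M)).
Proof.
move=> [B cB [Bo Bb]] mf oO.
(* Countability comes from [M] alone: [V b] is the largest open set whose product with [b] lies in
   [O], so one rectangle per basic set is enough. *)
pose V b := \bigcup_(U in [set U : set Y | open U /\ b `*` U `<=` O]) U.
have -> : [set p | O (p, f p)] = \bigcup_(b in B) (b `&` f @^-1` V b).
  apply/seteqP; split => [p /= Op|p [b Bbb [bp [U [oU bU] Up]]]]; last by apply: bU.
  have : nbhs (p, f p) O by exact: open_nbhs_nbhs.
  case=> -[P Q] /= [nP nQ] PQ.
  have [b [Bbb bp] bP] := Bb p P nP.
  exists b => //; split=> //; exists (interior Q); last exact: nQ.
  split; first exact: open_interior.
  by move=> [x y] [/= bx Qy]; apply: PQ; split; [exact: bP|exact: interior_subset].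
apply: countable_bigcup_measurable => // b Bbb; apply: measurableI.
  by apply: sub_sigma_algebra; exact: Bo.
by apply: mf; apply: sub_sigma_algebra; apply: bigcup_open => U [].
Qed.

End SecondCountable.

Lemma ltr_quarters (R : realFieldType) (e a b c : R) :
  a < e / 4 -> b < e / 4 -> c < e / 4 + e / 4 -> a + (b + c) < e.
Proof.
move=> ae be ce; rewrite (_ : e = e / 4 + (e / 4 + (e / 4 + e / 4))); last first.
  apply: (@mulIf _ (4 : R)); first by [].
  by rewrite !mulrDl !divfK// mulr_natr.
by rewrite ltrD// ltrD.
Qed.

(** * Local trivializations of the completed bundle *)

Section Bundle.
Variables (R : realType) (n : nat) (M : ptopologicalType).
Variables (A : smooth_atlas R n M) (g0 : riemannian_metric A).
Variable mu : {measure set (borel M) -> \bar R}.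
Variable V : volume_cover A mu.
Hypothesis vol : volume_measure g0 mu.
Local Notation spdR := (spd R n).
Local Notation spdB := (spd_bar R n).
Local Notation DB := (@spd_bar_dist R n).
Local Notation pmS := (@spd_pseudo_metric R n).

Lemma vchart_at p c : vcharts V c -> cdom c p -> charts_at A p c.
Proof. by move=> Vc cp; split=> //; exact: vcharts_smooth Vc. Qed.

Lemma vchart_isometry p c (Vc : vcharts V c) (cp : charts_at A p c)
    (h k : pos_tensor A p) :
  spd_dist (coord_matrix cp h) (coord_matrix cp k) = fiber_dist g0 h k.
Proof.
apply: coord_matrix_isometry; apply: (volume_chart_det vol).
- by case: cp.
- exact: vcharts_volume Vc.
- by case: cp.
Qed.

(** Pulled back from the model fiber by a volume chart at [p], so that curves are studied on the
    model only. *)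
Lemma fiber_pseudo_metric p : pseudo_metric (@fiber_dist R n M A g0 p).
Proof.
have [c Vc cp] := vcharts_cover V p.
have iso := vchart_isometry Vc (vchart_at Vc cp).
split=> [x|x y|x y z]; rewrite -!iso.
- exact: pm_xx pmS _.
- exact: pm_sym pmS _ _.
- exact: pm_triangle pmS _ _ _.
Qed.

Definition triv p c (Vc : vcharts V c) (cp : charts_at A p c) :
  fiber_bar g0 p -> spdB := completion_map (vchart_isometry Vc cp).

Lemma triv_bij p c (Vc : vcharts V c) (cp : charts_at A p c) : bijective (triv Vc cp).
Proof.
by refine (completion_map_bij (fiber_pseudo_metric p) pmS _ (coord_matrix_bij cp)).
Qed.

Lemma triv_dist p c (Vc : vcharts V c) (cp : charts_at A p c) y z :
  DB (triv Vc cp y) (triv Vc cp z) = fiber_bar_dist y z.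
Proof. exact: completion_map_dist (fiber_pseudo_metric p) pmS _ _ _ _. Qed.

Lemma triv_graphP p c (Vc : vcharts V c) (cp : charts_at A p c) y z :
  completion_map_graph (coord_matrix cp) y z <-> z = triv Vc cp y.
Proof. exact: completion_map_graphP (fiber_pseudo_metric p) pmS _ _ _ _. Qed.

Definition spd_in (H : spdR) : spdB := completion_in (pm_xx pmS) H.

Lemma spd_in_dist H K : DB (spd_in H) (spd_in K) = spd_dist H K.
Proof. exact: completion_in_dist pmS _ _ _. Qed.

Lemma triv_in p c (Vc : vcharts V c) (cp : charts_at A p c) fxx h :
  triv Vc cp (completion_in fxx h) = spd_in (coord_matrix cp h).
Proof. exact: completion_map_in (fiber_pseudo_metric p) pmS _ _ _ _ _. Qed.

Let pmB : pseudo_metric DB := completion_pseudo_metric pmS.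

Lemma nbhs_ball_bar (z : spdB) e : 0 < e -> nbhs z [set w | DB z w < e].
Proof.
move=> e0; apply: open_nbhs_nbhs; split; last by rewrite /= (pm_xx pmB).
move=> w /= zw; exists (e - DB z w); first by rewrite subr_gt0.
move=> y; rewrite ltrBrDl; apply: le_lt_trans; exact: pm_triangle pmB _ _ _.
Qed.

(** This is joint continuity of the changes of trivialization. The point [z0] is approximated by a
    matrix [H0]; on [H0] the change is congruence by the Jacobian, continuous in the base point, and
    the distance to [H0] is the same in both trivializations. *)
Lemma trans_bundle_open c (Vc : vcharts V c) (U : set spdB) : open U ->
  bundle_open (g0 := g0) V [set w : bundle_bar g0 |
    exists cp : charts_at A (projT1 w) c, U (triv Vc cp (projT2 w))].
Proof.
move=> oU c' Vc'; rewrite openE => -[p0 z0] /= [cp0' [y0 [[/= cp0 Uy0]]]].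
move=> /(triv_graphP Vc') z0E.
have [e e0 eU] : exists2 e, 0 < e & forall w, DB (triv Vc cp0 y0) w < e -> U w.
  exact: oU.
(* Four errors add up: the distance from [z0] to [H0], counted twice, the displacement of the image
   of [H0] as the base point moves, and the distance from [z0] to [z]. *)
have e4 : 0 < e / 4 by rewrite divr_gt0.
have [H0 zH0] := completion_dense pmS (pm_xx pmS) z0 e4.
(* The tensor at [q] with matrix [H0] in the chart [c'], read in the chart [c]. *)
pose T q (cq : charts_at A q c) (cq' : charts_at A q c') :=
  coord_matrix cq (tensor_of_matrix cq' H0).
have TE q cq cq' : sval (T q cq cq') = jac c c' q *m sval H0 *m (jac c c' q)^T.
  by rewrite -(tensor_of_matrixE cq' H0); exact: tmat_change.
have cJ : {for p0, continuous (fun q => jac c c' q *m sval H0 *m (jac c c' q)^T)}.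
  have cJ := jac_continuous cp0 cp0'.
  apply: (@cvg_mulmx _ _ (nbhs p0) _ _ _ _ (fun q => jac c c' q *m sval H0) (fun q => (jac c c' q)^T)).
    by apply: (@cvg_mulmx _ _ (nbhs p0) _ _ _ _ (jac c c') (fun=> sval H0)) => //; apply: cvg_cst.
  exact: (@cvg_trmx _ _ (nbhs p0) _ _ _ (jac c c')).
have nT : \forall q \near p0, forall (cq : charts_at A q c) (cq' : charts_at A q c'),
    spd_dist (T p0 cp0 cp0') (T q cq cq') < e / 4.
  have := spd_dist_near (T p0 cp0 cp0') e4; rewrite TE => /cJ.
  by apply: (@filterS _ (nbhs p0)) => q /= Hq cq cq'; apply: Hq; rewrite TE.
exists ([set q | (cdom c `&` cdom c') q /\
   forall (cq : charts_at A q c) (cq' : charts_at A q c'),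
     spd_dist (T p0 cp0 cp0') (T q cq cq') < e / 4], [set w | DB z0 w < e / 4]).
  split => /=; last exact: nbhs_ball_bar.
  apply: filterI => //; apply: open_nbhs_nbhs; split.
    by apply: openI; exact: cdom_open.
  by split; [exact: (proj2 cp0)|exact: (proj2 cp0')].
move=> [q z] /= [[[cq cq'] Hq] zz].
pose qc := vchart_at Vc cq; pose qc' := vchart_at Vc' cq'.
have [g gK Kg] := triv_bij Vc' qc'.
exists qc', (g z); split; last by apply/(triv_graphP Vc'); rewrite Kg.
exists qc; apply: eU => /=.
have dxx q' := pm_xx (fiber_pseudo_metric q').
have step q' (cq1 : charts_at A q' c) (cq2 : charts_at A q' c') y :
    DB (triv Vc cq1 y) (spd_in (T q' cq1 cq2)) = DB (triv Vc' cq2 y) (spd_in H0).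
  rewrite -(triv_in Vc cq1 (dxx q')) triv_dist -(triv_dist Vc' cq2) triv_in.
  by congr (DB _ (spd_in _)); apply: spd_eq; exact: tensor_of_matrixE.
apply: (@le_lt_trans _ _ (DB (triv Vc cp0 y0) (spd_in (T p0 cp0 cp0')) +
   (DB (spd_in (T p0 cp0 cp0')) (spd_in (T q qc qc')) + DB (spd_in (T q qc qc')) (triv Vc qc (g z))))).
  apply: le_trans (pm_triangle pmB _ (spd_in (T p0 cp0 cp0')) _) _.
  by rewrite lerD2l; exact: pm_triangle pmB _ _ _.
have E1 : DB (triv Vc cp0 y0) (spd_in (T p0 cp0 cp0')) = DB z0 (spd_in H0).
  by rewrite z0E; exact: step.
have E3 : DB (spd_in (T q qc qc')) (triv Vc qc (g z)) = DB z (spd_in H0).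
  by apply: etrans (pm_sym pmB _ _) _; apply: etrans (step _ _ qc' _) _; rewrite Kg.
rewrite E1 E3 spd_in_dist.
have zH : DB z (spd_in H0) < e / 4 + e / 4.
  apply: le_lt_trans (pm_triangle pmB _ z0 _) _.
  by rewrite (pm_sym pmB z z0) ltrD.
exact: ltr_quarters zH0 (Hq qc qc') zH.
Qed.

End Bundle.

(** * Gluing along a finite Borel partition *)

Section FirstIndex.
Variables (M : ptopologicalType) (N : M -> set M).

Definition first_index (L : seq M) (q : M) : nat := find (fun p => `[< N p q >]) L.

Lemma measurable_first_index L i : (forall p, open (N p)) ->
  measurable ([set q | first_index L q = i] : set (borel M)).
Proof.
move=> oN; elim: L i => [|p L IH] i.
  rewrite /first_index /=; have [->|i0] := eqVneq i 0%N.
    by rewrite (_ : [set _ | _] = setT)//; apply/seteqP; split.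
  rewrite (_ : [set _ | _] = set0)//; apply/seteqP; split => // q /= qi.
  by move/eqP: i0; rewrite -qi.
case: i => [|i].
  rewrite (_ : [set _ | _] = N p); first exact: open_borel.
  apply/seteqP; split => q; rewrite /first_index /=.
    by case: asboolP.
  by move=> Nq; rewrite asboolT.
rewrite (_ : [set _ | _] = ~` (N p) `&` [set q | first_index L q = i]).
  by apply: measurableI => //; apply: measurableC; exact: open_borel.
apply/seteqP; split => q; rewrite /first_index /=.
  by case: asboolP => // nq [].
by move=> [nq <-]; rewrite asboolF.
Qed.

(** On each piece [Q] is cut out by a single Borel set [S p]. The default of [nth] varies with [q];
    the bound on the index is what makes [p] depend on the piece only. *)
Lemma measurable_first_pointwise L (Q : set M) (S : M -> set (borel M)) :
  (forall p, open (N p)) -> (forall q, (first_index L q < size L)%N) ->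
  (forall p, measurable (S p)) ->
  (forall q, Q q <-> S (nth q L (first_index L q)) q) ->
  measurable (Q : set (borel M)).
Proof.
move=> oN Ls mS QS; rewrite (_ : Q = \bigcup_(i in [set i | (i < size L)%N])
   ([set q | first_index L q = i] `&` S (nth point L i))).
  apply: bigcup_measurable => i _; apply: measurableI => //.
  exact: measurable_first_index.
apply/seteqP; split => q.
  move=> /QS Sq; exists (first_index L q); first exact: Ls.
  by split=> //; rewrite (set_nth_default q).
by move=> [i /= iL [qi Sq]]; apply/QS; rewrite qi (set_nth_default point).
Qed.

End FirstIndex.

(** * Construction of the isometry *)

Section Main.
Variables (R : realType) (n : nat) (M : ptopologicalType).
Variables (A : smooth_atlas R n M) (g0 : riemannian_metric A).
Variable mu : {measure set (borel M) -> \bar R}.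
Variable V : volume_cover A mu.
Hypothesis vol : volume_measure g0 mu.
Local Notation spdR := (spd R n).
Local Notation spdB := (spd_bar R n).
Local Notation DB := (@spd_bar_dist R n).
Local Notation pmS := (@spd_pseudo_metric R n).

Let spd1 : spdR := exist _ _ (@posdef1 R n).

(** By continuity the matrix of [g0] in a volume chart stays within distance 1 of its value at [p];
    the bound is 1 plus the distance of that value from the identity. *)
Lemma metric_locally_bounded p : exists N c K, [/\ open N, N p, vcharts V c,
  N `<=` cdom c & forall q (cq : charts_at A q c), N q ->
    spd_dist (coord_matrix cq (g0 q)) spd1 <= K].
Proof.
have [c Vc cp] := vcharts_cover V p; have pc := vchart_at Vc cp.
pose G (q : M) : 'M[R]_n := g0 (cinv c (cmap c q)) c.
have GE q : cdom c q -> G q = g0 q c by move=> cq; rewrite /G cmapK.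
have cG : {for p, continuous G}.
  apply: (@continuous_comp _ _ _ (cmap c) (fun x => g0 (cinv c x) c : 'M[R]_n)).
    exact: cmap_continuous.
  by apply: riemannian_metric_continuous => //; case: pc.
pose W q := cdom c q /\ forall cq : charts_at A q c,
    spd_dist (coord_matrix pc (g0 p)) (coord_matrix cq (g0 q)) < 1.
have nW : nbhs p W.
  have nc : \forall q \near p, cdom c q by exact: open_nbhs_nbhs (conj (cdom_open c) cp).
  have := spd_dist_near (coord_matrix pc (g0 p)) ltr01; rewrite /= -GE// => /cG nG.
  apply: (@filterS2 _ (nbhs p) _ _ _ _ _ nc nG) => q cq Hq; split=> // cq'.
  by apply: Hq; rewrite /= GE.
exists (interior W), c, (1 + spd_dist (coord_matrix pc (g0 p)) spd1); split=> //.
- exact: open_interior.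
- by move=> q /interior_subset[].
- move=> q cq /interior_subset[_ Wq].
  apply: le_trans (pm_triangle pmS _ (coord_matrix pc (g0 p)) _) _.
  by rewrite lerD2r (pm_sym pmS) ltW.
Qed.

Theorem sections_isometric_maps : @second_countable M -> compact [set: M] ->
  mu [set: M] = 1%E ->
  isometric (@L2_sections_dist R n M A g0 mu V) (@L2_maps_dist R n M mu).
Proof.
move=> sc cpt vol1.
pose N p := sval (cid (metric_locally_bounded p)).
pose ch p := sval (cid (svalP (cid (metric_locally_bounded p)))).
pose K p := sval (cid (svalP (cid (svalP (cid (metric_locally_bounded p)))))).
have HF p : [/\ open (N p), N p p, vcharts V (ch p), N p `<=` cdom (ch p) &
    forall q (cq : charts_at A q (ch p)), N p q ->
      spd_dist (coord_matrix cq (g0 q)) spd1 <= K p].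
  exact: svalP (cid (svalP (cid (svalP (cid (metric_locally_bounded p)))))).
move: N ch K HF => N ch K HF.
have oN p : open (N p) by case: (HF p).
have Np p : N p p by case: (HF p).
have Vch p : vcharts V (ch p) by case: (HF p).
have Nch p : N p `<=` cdom (ch p) by case: (HF p).
have [L HL] : exists L : seq M, forall q, has (fun p => `[< N p q >]) L.
  move: cpt; rewrite compact_cover => /(_ M setT N (fun p _ => oN p)) [|D _ HD].
    by move=> q _; exists q.
  exists (finmap.enum_fset D) => q; have [p Dp Nq] := HD q I.
  by apply/hasP; exists p => //; apply/asboolP.
pose pt q := nth q L (first_index N L q).
have Npt q : N (pt q) q by exact: (asboolW (nth_find q (HL q))).
have Lsize q : (first_index N L q < size L)%N by rewrite -has_find.
pose Vq q : vcharts V (ch (pt q)) := Vch (pt q).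
pose cq q : charts_at A q (ch (pt q)) := vchart_at (Vq q) (Nch _ _ (Npt q)).
pose Phi q : fiber_bar g0 q -> spdB := triv vol (Vq q) (cq q).
(* The chart used by [Phi] and the proof that it is a chart at [q] both vary with [q]; on one piece
   they are replaced by a fixed chart and an arbitrary proof. *)
have PhiE q p (e : pt q = p) (cp : charts_at A q (ch p)) y :
    Phi q y = triv vol (Vch p) cp y.
  by subst p; rewrite /Phi (Prop_irrelevance (cq q) cp).
have Phi_bij q : bijective (Phi q) by exact: triv_bij.
have Phi_surj q z : exists y, Phi q y = z.
  by have [g gK Kg] := Phi_bij q; exists (g z).
pose Psi q z := sval (cid (Phi_surj q z)).
have PsiK q : cancel (Psi q) (Phi q) by move=> z; exact: svalP (cid (Phi_surj q z)).
have PhiK q : cancel (Phi q) (Psi q).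
  by move=> y; apply: (bij_inj (Phi_bij q)); rewrite PsiK.
have Phi_dist q y z : DB (Phi q y) (Phi q z) = fiber_bar_dist y z by exact: triv_dist.
have pmB : pseudo_metric DB := completion_pseudo_metric pmS.
(* The list [L] is finite, so the local bounds have a common maximum. *)
have [C HC] : exists C, forall q, DB (Phi q (g0_section g0 q)) (spd_in spd1) <= C.
  exists (\big[Num.max/0]_(p <- L) K p) => q.
  rewrite /Phi /g0_section triv_in spd_in_dist.
  have [_ _ _ _ H] := HF (pt q); apply: le_trans (H q (cq q) (Npt q)) _.
  by apply: le_bigmax_seq => //; apply: mem_nth.
have C0 : 0 <= C by apply: le_trans (HC point); exact: pm_ge0.
(* Turns the triangle inequality into an affine bound between squared distances; this is the origin
   of the factor 2 below. *)
have sq2 (a b c : R) : 0 <= a -> 0 <= b -> 0 <= c -> a <= b + c ->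
    a ^+ 2 <= 2 * (b ^+ 2 + c ^+ 2).
  move=> a0 b0 c0 abc; apply: (@le_trans _ _ ((b + c) ^+ 2)).
    by rewrite ler_pXn2r// nnegrE addr_ge0.
  have := sqr_ge0 (b - c); rewrite sqrrB addrAC subr_ge0 => bc.
  by rewrite sqrrD addrAC mulr_natl mulr2n lerD2l.
have muT : (mu [set: M] < +oo)%E by rewrite vol1 ltry.
apply: (@ae_classes_isometric _ _ mu _ _ _ _ _ _ Phi Psi PhiK PsiK Phi_dist).
  move=> s [bs fs]; split.
    apply: borel_map_open => U oU.
    (* On the piece attached to [p], the preimage of [U] under the map is the preimage under the
       section of the open set [W p] of the bundle. *)
    pose W p : set (bundle_bar g0) := [set w |
      exists cp : charts_at A (projT1 w) (ch p), U (triv vol (Vch p) cp (projT2 w))].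
    apply: (@measurable_first_pointwise _ N L _
      (fun p => (fun q => existT _ q (s q)) @^-1` W p)) => // [p|q].
      by apply: bs; apply: sub_sigma_algebra; exact: trans_bundle_open.
    split=> [Uq|[/= cp]]; first by exists (cq q).
    by rewrite -PhiE.
  exists (spd_in spd1).
  apply: (@integral_affine_bound_nm _ _ _ mu _ _ 2 (C ^+ 2) muT (ler0n _ 2)
    (sqr_ge0 C) _ _ _ fs) => p; try exact: sqr_ge0.
  apply: sq2; rewrite ?(pm_ge0 pmB)//.
    by rewrite -Phi_dist (pm_ge0 pmB).
  apply: le_trans (pm_triangle pmB _ (Phi p (g0_section g0 p)) _) _.
  by rewrite Phi_dist lerD2l.
move=> f [bf [a fa]]; split.
  apply: borel_map_open => W oW.
  (* Openness of [W] in the bundle says that each [Wc p] is open in the product, so the graph of [f]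
     meets it over a Borel set. *)
  pose Wc p : set (M * spdB) := [set z : M * spdB | exists (cp : charts_at A z.1 (ch p))
      (y : fiber_bar g0 z.1), W (existT _ z.1 y) /\
        completion_map_graph (coord_matrix cp) y z.2].
  apply: (@measurable_first_pointwise _ N L _ (fun p => [set q | Wc p (q, f q)])) => // [p|q].
    by apply: (measurable_graph_open sc bf); exact: oW.
  split=> [Wq|[/= cp [y [Wy]]]].
    exists (cq q), (Psi q (f q)); split=> //.
    by apply/(triv_graphP vol (Vq q)); rewrite -/(Phi q _) PsiK.
  move=> /(triv_graphP vol (Vch (pt q))) fE; rewrite /preimage /=.
  by rewrite fE -(PhiE q (pt q) erefl) PhiK.
(* Moves the arbitrary centre [a] to the identity, and then to [g0] at cost [C]. *)
pose C' := C + DB a (spd_in spd1).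
have C'0 : 0 <= C' by rewrite addr_ge0// pm_ge0.
apply: (@integral_affine_bound_nm _ _ _ mu _ _ 2 (C' ^+ 2) muT (ler0n _ 2)
  (sqr_ge0 C') _ _ _ fa) => p; try exact: sqr_ge0.
apply: sq2; rewrite ?(pm_ge0 pmB)//; first by rewrite -Phi_dist (pm_ge0 pmB).
rewrite -Phi_dist PsiK.
apply: le_trans (pm_triangle pmB _ a _) _; rewrite lerD2l.
apply: le_trans (pm_triangle pmB _ (spd_in spd1) _) _.
by rewrite addrC lerD2r (pm_sym pmB).
Qed.

End Main.

Theorem theorem3 (R : realType) (n : nat) (hn : (1 <= n)%N)
    (M : ptopologicalType) (A : smooth_atlas R n M)
    (haus : hausdorff_space M) (sc : @second_countable M)
    (cpt : compact [set: M]) (ori : orientable A)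
    (g0 : riemannian_metric A)
    (mu : {measure set (borel M) -> \bar R}) (vol : volume_measure g0 mu)
    (vol1 : mu [set: M] = 1%E)
    (V : volume_cover A mu) :
  isometric (@L2_sections_dist R n M A g0 mu V) (@L2_maps_dist R n M mu).
Proof. exact: sections_isometric_maps. Qed.
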